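(* Let $p>2$, $H>0$, $0<\varphi<\pi/2$, $f\in L^1(-1,1)$, and let $u\in W_0^{1,p}(-1,1)$ be a weak solution to problem (P). If $f\ge 0$ a.e. in $(-1,1)$ and $f\not\equiv 0$ (i.e. $f$ is not a.e. equal to zero), then $u>0$ on $(-1,1)$.
   Context: Problem (P) is the boundary value problem $-\frac{d}{dx}\big[(u(x)+H)\,|u'(x)\cos\varphi+\sin\varphi|^{p-2}(u'(x)\cos\varphi+\sin\varphi)\big]=f(x)$ for $x\in(-1,1)$, $u(-1)=u(1)=0$. A weak solution to (P) is a function $u\in W_0^{1,p}(-1,1)$ with $u\ge -H$ such that $\int_{-1}^1 (u+H)|u'\cos\varphi+\sin\varphi|^{p-2}(u'\cos\varphi+\sin\varphi)\,v'\,dx=\int_{-1}^1 f v\,dx$ for all $v\in W_0^{1,p}(-1,1)$ (weak derivatives). Functions in $W^{1,p}_0(-1,1)$ are identified with their absolutely continuous representatives on $[-1,1]$. *)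

(* Defs.v *)
From HB Require Import structures.
From mathcomp Require Import all_boot all_order all_algebra.
From mathcomp Require Import all_classical all_reals all_analysis.

Set Implicit Arguments.
Unset Strict Implicit.
Unset Printing Implicit Defensive.

Import Order.TTheory GRing.Theory Num.Theory.
Import numFieldNormedType.Exports.

Local Open Scope classical_set_scope.
Local Open Scope ring_scope.

Section Definitions.
Context {R : realType}.

Notation mu := (@lebesgue_measure R).

Definition Omega : set R := `]-1, 1[.

(* Functions on Omega are represented by functions on R; only their values on
   Omega (or, for absolutely continuous representatives, on [-1, 1]) matter. *)

Definition LpOmega (p : R) (g : R -> R) : Prop :=
  g \_ Omega \in Lfun mu p%:E.

Definition LpOmega_norm (p : R) (g : R -> R) : \bar R :=
  'N[mu]_(p%:E)[EFin \o (g \_ Omega)]%E.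

(* C_c^oo(Omega), each function being extended by 0 to R. *)
Definition test_function (psi : R -> R) : Prop :=
  (forall (n : nat) (x : R), derivable (derive1n n psi) x 1) /\
  (compact (closure [set x | psi x != 0]) /\
   closure [set x | psi x != 0] `<=` Omega).

Definition weak_derivative (u du : R -> R) : Prop :=
  forall psi : R -> R, test_function psi ->
    \int[mu]_(x in Omega) (u x * derive1 psi x) =
    - \int[mu]_(x in Omega) (du x * psi x).

(* u is in W^{1,p}(Omega) and du is (a representative of) its weak derivative. *)
Definition W1p (p : R) (u du : R -> R) : Prop :=
  [/\ LpOmega p u, LpOmega p du & weak_derivative u du].

Definition abs_continuous (a b : R) (u : R -> R) : Prop :=
  forall eps : R, 0 < eps -> exists2 delta : R, 0 < delta &
    forall (n : nat) (x y : 'I_n -> R),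
      (forall i, a <= x i /\ x i <= y i /\ y i <= b) ->
      trivIset [set: 'I_n] (fun i => [set` `]x i, y i[]) ->
      \sum_(i < n) (y i - x i) < delta ->
      \sum_(i < n) `|u (y i) - u (x i)| < eps.

(* u is the absolutely continuous representative on [-1, 1] of an element of
   W_0^{1,p}(Omega), the closure of C_c^oo(Omega) in W^{1,p}(Omega), and du is
   a representative of its weak derivative. *)
Definition W01p (p : R) (u du : R -> R) : Prop :=
  [/\ W1p p u du,
      abs_continuous (-1) 1 u &
      exists psi : nat -> R -> R,
        [/\ forall n, test_function (psi n),
            LpOmega_norm p (psi n \- u) @[n --> \oo] --> 0%E &
            LpOmega_norm p (derive1 (psi n) \- du) @[n --> \oo] --> 0%E]].

(* The quantity u' cos(varphi) + sin(varphi), with du in the role of u'. *)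
Definition slope (varphi : R) (du : R -> R) (x : R) : R :=
  du x * cos varphi + sin varphi.

(* Weak derivatives are unique up to a.e. equality and only occur under
   integrals, so the choice of the representatives du, dv is immaterial. *)
Definition weak_solution (p H varphi : R) (f u : R -> R) : Prop :=
  exists du : R -> R,
    [/\ W01p p u du,
        (forall x : R, -1 <= x <= 1 -> - H <= u x) &
        forall v dv : R -> R, W01p p v dv ->
          \int[mu]_(x in Omega)
            ((u x + H) * (`|slope varphi du x| `^ (p - 2) * slope varphi du x)
             * dv x) =
          \int[mu]_(x in Omega) (f x * v x)].

End Definitions.

(* Main.v *)
(** Write [s = u' cos varphi + sin varphi], [S = sin varphi] and
    [F = (u + H) |s|^(p-2) s].  Testing the equation with smooth steps shows
    that [F] agrees almost everywhere with the continuous nonincreasing function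
    [G x = c - \int_(-1)^x f].  Put [g0 = H S^(p-1)], the value of the flux
    where [u = u' = 0], and suppose [u x0 <= 0].

    If [G x0 >= g0], then [G >= g0] on [[-1, x0]]; there [u' >= 0] wherever
    [u <= 0], and [u' >= - C u] wherever [u >= 0].  As [u (-1) = 0], the first
    property gives [u >= 0], and Gronwall's inequality going backward from [x0]
    gives [u = 0] on [[-1, x0]].  If [G x0 <= g0], then on [[x0, 1]] one has
    [u' <= 0] wherever [u >= 0], and [(u + H) u' <= - (tan varphi) u] wherever
    [u <= 0]; as [u 1 = 0], Gronwall's inequality going backward from a zero of
    [u] excludes negative values, and again [u = 0] on [[x0, 1]].

    In both cases [G = g0] on the corresponding side, hence [G x0 = g0], so that
    both cases apply: [G] is constant on [[-1, 1]] and [f = 0] almost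
    everywhere. *)

Require Import Defs.
From HB Require Import structures.
From mathcomp Require Import all_boot all_order all_algebra.
From mathcomp Require Import all_classical all_reals all_analysis.
From mathcomp Require Import measurable_realfun ring lra.

Import Order.TTheory GRing.Theory Num.Theory.
Import numFieldNormedType.Exports.

Local Open Scope classical_set_scope.
Local Open Scope ring_scope.

(** * A smooth transition function built from exp(-1/x) *)

Section SmoothStep.
Context {R : realType}.

(** Induction on [P] with the rate [e] left general: half of the rate absorbs the shorter
    polynomial, the other half the new factor [y], by 1 + t <= exp t. *)
Lemma horner_le_expR (P : {poly R}) (e : R) : 0 < e ->
  exists2 C : R, 0 <= C & forall y, 0 <= y -> `|P.[y]| <= C * expR (e * y).
Proof.
elim/poly_ind: P e => [|P c IH] e e0.
  by exists 0 => // y _; rewrite horner0 normr0 mul0r.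
have e20 : 0 < e / 2 by rewrite divr_gt0.
have [C C0 HC] := IH _ e20.
exists (C * (2 / e) + `|c|) => [|y y0].
  by rewrite addr_ge0 // mulr_ge0 // divr_ge0 // ltW.
rewrite hornerMXaddC (le_trans (ler_normD _ _)) // mulrDl lerD //; last first.
  by rewrite ler_peMr // -expR0 ler_expR mulr_ge0 // ltW.
have -> : e * y = (e / 2) * y + (e / 2) * y by field.
rewrite expRD normrM (ger0_norm y0).
have yle : y <= 2 / e * expR (e / 2 * y).
  have h := expR_ge1Dx (e / 2 * y).
  rewrite mulrC -ler_pdivrMr ?divr_gt0 // invf_div.
  by apply: le_trans h; rewrite mulrC lerDr.
apply: le_trans (ler_pM (normr_ge0 _) y0 (HC _ y0) yle) _.
by rewrite le_eqVlt; apply/orP; left; apply/eqP; ring.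
Qed.

(** The functions P(1/x) exp(-1/x), extended by 0. Letting [P] vary makes the family stable under
    differentiation. *)
Definition flat (P : {poly R}) (x : R) : R :=
  if 0 < x then P.[x^-1] * expR (- x^-1) else 0.

Lemma flat_le0 (P : {poly R}) x : x <= 0 -> flat P x = 0.
Proof. by rewrite /flat ltNge => ->. Qed.

(** The exponential bound at y = 1/x, applied to [P] times the square of the variable, leaves a
    spare factor x^2. This gives derivative 0 at the origin. *)
Lemma flat_quadratic (P : {poly R}) :
  exists2 C : R, 0 <= C & forall x, `|flat P x| <= C * x ^+ 2.
Proof.
have [C C0 HC] := horner_le_expR (P * 'X * 'X) _ ltr01.
exists C => // x; rewrite /flat; case: ifPn => [x0|_]; last first.
  by rewrite normr0 mulr_ge0 // sqr_ge0.
have y0 : 0 <= x^-1 by rewrite invr_ge0 ltW.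
have := HC _ y0; rewrite !hornerMX mul1r !normrM (ger0_norm y0) => h.
rewrite (ger0_norm (expR_ge0 _)) expRN ler_pdivrMr ?expR_gt0 //.
rewrite mulrAC -ler_pdivrMr ?exprn_gt0 //.
by rewrite expr2 invfM mulrA.
Qed.

(** With y = 1/x one has d/dx = -y^2 d/dy, which turns P(y) exp(-y) into y^2 (P - P')(y) exp(-y). At
    0 the difference quotient is controlled by the quadratic bound. *)
Lemma is_derive_flat (P : {poly R}) (x : R) :
  is_derive x 1 (flat P) (flat (('X * 'X) * (P - P^`())) x).
Proof.
have [x0|x0|x0] := ltrgtP x 0.
- rewrite flat_le0 ?ltW //.
  apply: (@near_eq_is_derive _ _ _ (cst 0)).
  near=> y; rewrite flat_le0 //.
  by apply/ltW; near: y; exact: lt_nbhsl.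
- have xN0 : x != 0 by rewrite gt_eqF.
  apply: (@near_eq_is_derive _ _ _
     ((horner P \o (fun y => y^-1)) * (expR \o (fun y => - y^-1)))).
    near=> y; rewrite /flat ifT //.
    by near: y; exact: lt_nbhsr.
  have dV : is_derive x 1 (fun y : R => y^-1) (- x ^- 2).
    apply: is_derive_eq.
      by apply: (@is_deriveV _ id) => //; exact: is_derive_id.
    by rewrite /= [_ *: _]mulr1.
  have dP := is_derive1_comp (is_derive_poly P x^-1) dV.
  have dE : is_derive x 1 (expR \o (fun y : R => - y^-1))
      (expR (- x^-1) * - - x ^- 2).
    by apply: is_derive1_comp; exact: is_deriveN.
  apply: is_derive_eq (is_deriveM dP dE) _.
  rewrite /flat x0 /= !hornerE.
  by rewrite /GRing.scale /=; field.
- rewrite x0 flat_le0 //.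
  have [C C0 HC] := flat_quadratic P.
  suff h : (fun h => h^-1 *: ((flat P \o shift 0) (h *: 1) - flat P 0))
       @ 0^' --> (0 : R).
    by apply: DeriveDef; [apply/cvg_ex; exists 0 | exact: cvg_lim].
  apply/cvgr0Pnorm_le => e e0.
  (* [C + 1] replaces [C], which may be 0. *)
  have Ce : 0 < e / (C + 1) by rewrite divr_gt0 // ltr_wpDl.
  near=> h.
  have h0 : h != 0 by near: h; exact: nbhs_dnbhs_neq.
  rewrite /= addr0 [flat P 0]flat_le0 // subr0 [_ *: 1]mulr1 normrZ normfV.
  rewrite ler_pdivrMl ?normr_gt0 //.
  apply: le_trans (HC _) _; rewrite -real_normK ?num_real // expr2 mulrA mulrC.
  rewrite ler_wpM2l //.
  have : `|h| <= e / (C + 1).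
    near: h; apply: dnbhs0_le => //.
  move=> hC; apply: (@le_trans _ _ ((C + 1) * (e / (C + 1)))).
    by rewrite ler_pM // lerDl.
  by rewrite mulrC divfK // gt_eqF // ltr_wpDl.
Unshelve. all: by end_near. Qed.

(* The class is closed under differentiation, which gives derivability at all
   orders without any Leibniz or Faa di Bruno formula. *)
Inductive smooth_fun : (R -> R) -> Prop :=
| smooth_flat P : smooth_fun (flat P)
| smooth_cst c : smooth_fun (cst c)
| smooth_add f g : smooth_fun f -> smooth_fun g -> smooth_fun (f + g)
| smooth_mul f g : smooth_fun f -> smooth_fun g -> smooth_fun (f * g)
| smooth_affine f k c :
    smooth_fun f -> smooth_fun (f \o (fun x => k * x + c))
| smooth_inv f : smooth_fun f -> (forall x, f x != 0) ->
    smooth_fun (fun x => (f x)^-1).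

Lemma smooth_fun_derive f : smooth_fun f ->
  exists2 g, smooth_fun g & forall x : R, is_derive x 1 f (g x).
Proof.
elim=> {f}.
- move=> P; exists (flat (('X * 'X) * (P - P^`()))); first exact: smooth_flat.
  exact: is_derive_flat.
- move=> c; exists (cst 0); first exact: smooth_cst.
  by move=> x; exact: is_derive_cst.
- move=> f g _ [f' sf' df] _ [g' sg' dg]; exists (f' + g').
    exact: smooth_add.
  by move=> x; exact: is_deriveD.
- move=> f g sf [f' sf' df] sg [g' sg' dg]; exists (f * g' + g * f').
    by apply: smooth_add; apply: smooth_mul.
  by move=> x; exact: is_deriveM.
- move=> f k c sf [f' sf' df].
  exists ((f' \o (fun x => k * x + c)) * cst k).
    by apply: smooth_mul; [exact: smooth_affine | exact: smooth_cst].
  move=> x; apply: is_derive1_comp.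
  have := is_deriveD (is_deriveZ k (is_derive_id x 1)) (is_derive_cst c x 1).
  by rewrite addr0 [k *: 1]mulr1.
- move=> f sf [f' sf' df] f0.
  exists (cst (-1) * (((fun x => (f x)^-1) * (fun x => (f x)^-1)) * f')).
    apply: smooth_mul; first exact: smooth_cst.
    by do 2 (apply: smooth_mul => //); exact: smooth_inv.
  move=> x; apply: is_derive_eq (is_deriveV (f0 x) (df x)) _.
  rewrite -[LHS]/(- f x ^- 2 * f' x) -[RHS]/(-1 * ((f x)^-1 * (f x)^-1 * f' x)).
  by rewrite expr2 invfM mulN1r mulNr.
Qed.

Lemma smooth_fun_derive1 f : smooth_fun f -> smooth_fun f^`()%classic.
Proof.
move=> /smooth_fun_derive[g sg fg]; suff -> : f^`()%classic = g by [].
by apply/funext => x; rewrite derive1E; exact: derive_val.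
Qed.

Lemma smooth_fun_derivable f (x : R) : smooth_fun f -> derivable f x 1.
Proof. by move=> /smooth_fun_derive[g sg fg]; exact: ex_derive. Qed.

Lemma smooth_fun_derivable_derive1n f n (x : R) : smooth_fun f ->
  derivable (derive1n n f) x 1.
Proof.
elim: n f => [|n IH] f sf; first exact: smooth_fun_derivable.
by rewrite derive1Sn; apply: IH; exact: smooth_fun_derive1.
Qed.

Lemma flat1_gt0 x : 0 < x -> 0 < flat 1 x.
Proof. by move=> x0; rewrite /flat x0 hornerC mul1r expR_gt0. Qed.

Lemma flat1_ge0 x : 0 <= flat 1 x.
Proof. by have [/flat_le0->//|/flat1_gt0/ltW] := leP x 0. Qed.

(** The classical smooth transition from 0 to 1 across [0, 1]. The denominator never vanishes, since
    x and 1 - x are not both nonpositive. *)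
Definition step (x : R) : R := flat 1 x / (flat 1 x + flat 1 (1 - x)).

Let step_den x : 0 < flat 1 x + flat 1 (1 - x).
Proof.
have [x0|x0] := ltP 0 x; first by rewrite ltr_pwDl ?flat1_gt0 ?flat1_ge0.
by rewrite ltr_wpDl ?flat1_gt0 ?flat1_ge0 // subr_gt0 (le_lt_trans x0).
Qed.

Lemma smooth_step : smooth_fun step.
Proof.
have -> : step = flat 1 * (fun x => (flat 1 x + flat 1 (1 - x))^-1) by [].
apply: smooth_mul; first exact: smooth_flat.
apply: smooth_inv => [|x]; last by rewrite gt_eqF.
apply: smooth_add; first exact: smooth_flat.
have -> : (fun x => flat 1 (1 - x)) = flat 1 \o (fun x => (-1) * x + 1).
  by apply/funext => x; rewrite /= mulN1r addrC.
by apply: smooth_affine; exact: smooth_flat.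
Qed.

Lemma step_le0 x : x <= 0 -> step x = 0.
Proof. by move=> x0; rewrite /step flat_le0 // mul0r. Qed.

Lemma step_ge1 x : 1 <= x -> step x = 1.
Proof.
move=> x1; rewrite /step [flat 1 (1 - x)]flat_le0 ?subr_le0 // addr0 divff //.
by rewrite gt_eqF // flat1_gt0 // (lt_le_trans ltr01).
Qed.

Lemma step_ge0 x : 0 <= step x.
Proof. by rewrite divr_ge0 ?flat1_ge0 // ltW. Qed.

Lemma step_le1 x : step x <= 1.
Proof. by rewrite ler_pdivrMr // mul1r lerDl flat1_ge0. Qed.

Lemma derive1_step_out x : (x < 0) || (1 < x) -> step^`()%classic x = 0.
Proof.
move=> hx; rewrite derive1E.
rewrite (@near_eq_derive _ _ _ _ (cst (step x))) ?derive_cst //.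
case/orP: hx => hx; near=> y.
  rewrite /cst !step_le0 ?ltW //.
  by near: y; exact: lt_nbhsl.
rewrite /cst !step_ge1 ?ltW //.
by near: y; exact: lt_nbhsr.
Unshelve. all: by end_near. Qed.

End SmoothStep.

(** * Test functions as elements of [W01p], and integration over [Omega] *)

Section TestFunctions.
Context {R : realType}.
Notation mu := (@lebesgue_measure R).
Implicit Types (f g h v psi : R -> R) (D : set R).

Lemma bounded_in_le D h (M : R) :
  (forall x, D x -> `|h x| <= M) -> [bounded h x | x in D].
Proof.
move=> hM; exists M; split; first exact: num_real.
by move=> N MN x Dx /=; rewrite (le_trans (hM x Dx)) // ltW.
Qed.

Lemma integrable_mul_bounded D f h (M : R) : measurable D ->
  mu.-integrable D (EFin \o f) -> measurable_fun D h ->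
  (forall x, D x -> `|h x| <= M) ->
  mu.-integrable D (EFin \o (fun x => f x * h x)).
Proof.
move=> mD intf mh hM.
have := @integrableMl _ _ _ mu D mD (EFin \o f) h intf mh
  (bounded_in_le _ _ _ hM).
by apply: eq_integrable.
Qed.

Lemma integrable_scale D f (k : R) : measurable D ->
  mu.-integrable D (EFin \o f) ->
  mu.-integrable D (EFin \o (fun x => k * f x)).
Proof.
move=> mD intf; have := @integrableZl _ _ _ mu D mD k (EFin \o f) intf.
by apply: eq_integrable.
Qed.

Lemma integrable_sub D f g : measurable D ->
  mu.-integrable D (EFin \o f) -> mu.-integrable D (EFin \o g) ->
  mu.-integrable D (EFin \o (fun x => f x - g x)).
Proof.
move=> mD intf intg.
have := @integrableB _ _ _ mu D mD (EFin \o f) (EFin \o g) intf intg.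
by apply: eq_integrable.
Qed.

Lemma integrable_itv_bounded (a b : R) (b0 b1 : bool) h (M : R) :
  measurable_fun [set` Interval (BSide b0 a) (BSide b1 b)] h ->
  (forall x, x \in Interval (BSide b0 a) (BSide b1 b) -> `|h x| <= M) ->
  mu.-integrable [set` Interval (BSide b0 a) (BSide b1 b)] (EFin \o h).
Proof.
move=> mh hM; apply: measurable_bounded_integrable => //.
  by rewrite /= lebesgue_measure_itv /=; case: ifP => _; rewrite ?ltry.
exact: (bounded_in_le _ _ M).
Qed.

Lemma measurable_Omega : measurable (@Omega R).
Proof. exact: measurable_itv. Qed.

Lemma measurable_restrict_Omega f : measurable_fun setT f ->
  measurable_fun setT (f \_ (@Omega R)).
Proof.
move=> mf; apply: (measurable_restrictT f measurable_Omega).1.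
exact: measurable_funTS.
Qed.

Lemma LpOmega_bounded (p : R) f (M : R) : 0 < p -> measurable_fun setT f ->
  (forall x, `|f x| <= M) -> LpOmega p f.
Proof.
move=> p0 mf fM; rewrite /LpOmega inE; apply/andP; split; rewrite inE /=.
  exact: measurable_restrict_Omega.
have M0 : 0 <= M by apply: le_trans (fM 0).
rewrite /finite_norm unlock /Lnorm poweR_lty //.
apply: (@le_lt_trans _ _ (\int[mu]_(x in @Omega R) (M `^ p)%:E)%E); last first.
  rewrite integral_cst; last exact: measurable_Omega.
  rewrite /Omega /= lebesgue_measure_itv /=.
  by case: ifP => _; rewrite ?mule0 ?ltry.
rewrite [leRHS]integral_mkcond.
apply: ge0_le_integral => //=.
- apply/measurable_EFinP; apply: (measurableT_comp (measurable_powR p)).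
  apply: measurableT_comp => //.
  exact: measurable_restrict_Omega.
- apply: (measurable_restrictT (fun=> (M `^ p)%:E) measurable_Omega).1.
  exact: measurable_cst.
- move=> x _; rewrite !patchE; case: ifPn => _.
    by rewrite lee_fin; apply: ge0_ler_powR; rewrite ?nnegrE // ltW.
  by rewrite normr0 powR0 // gt_eqF.
Qed.

Lemma continuous_compact_support_bounded f : continuous f ->
  (forall x, ~ Omega x -> f x = 0) ->
  exists2 M : R, 0 <= M & forall x, `|f x| <= M.
Proof.
move=> cf f0.
have cnf : {within `[(-1 : R), 1], continuous (fun x => `|f x|)}.
  apply: continuous_subspaceT => x.
  by apply: continuous_comp; [exact: cf | exact: norm_continuous].
have [c _ hc] := @EVT_max R (fun x => `|f x|) (-1) 1 ltac:(lra) cnf.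
exists `|f c| => // x.
have [Ox|] := pselect (Omega x); last by move=> /f0 ->; rewrite normr0.
by apply: hc; move: Ox; rewrite /Omega /= !in_itv /= => /andP[/ltW -> /ltW ->].
Qed.

Section one_test_function.
Context (psi : R -> R) (tpsi : test_function psi).

Lemma test_derivable (x : R) : derivable psi x 1.
Proof. exact: (tpsi.1 0). Qed.

Lemma test_derivable_derive1 (x : R) : derivable psi^`()%classic x 1.
Proof. exact: (tpsi.1 1%N). Qed.

Lemma test_continuous : continuous psi.
Proof.
by move=> x; apply/differentiable_continuous/derivable1_diffP/test_derivable.
Qed.

Lemma test_continuous_derive1 : continuous psi^`()%classic.
Proof.
by move=> x; apply/differentiable_continuous/derivable1_diffP;
  exact: test_derivable_derive1.
Qed.

Lemma test_out x : ~ Omega x -> psi x = 0.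
Proof.
move=> Ox; apply/eqP/negPn/negP => px; apply: Ox.
by apply: tpsi.2.2; apply: subset_closure.
Qed.

Lemma test_derive1_out x : ~ Omega x -> psi^`()%classic x = 0.
Proof.
move=> Ox; rewrite derive1E (@near_eq_derive _ _ _ _ (cst 0)) ?derive_cst //.
(* The complement of the support is open, so [psi] vanishes on a whole neighbourhood of [x]. *)
have /open_nbhs_nbhs : open_nbhs x (~` closure [set x | psi x != 0]).
  split; first by apply: closed_openC; exact: closed_closure.
  by move=> /tpsi.2.2.
apply: filterS => y; rewrite /cst => cy.
apply/eqP/negPn/negP => py; apply: cy; exact: subset_closure.
Qed.

Lemma test_bounded : exists2 M : R, 0 <= M & forall x, `|psi x| <= M.
Proof.
exact: (continuous_compact_support_bounded _ test_continuous test_out).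
Qed.

Lemma test_derive1_bounded :
  exists2 M : R, 0 <= M & forall x, `|psi^`()%classic x| <= M.
Proof.
exact: (continuous_compact_support_bounded _ test_continuous_derive1
  test_derive1_out).
Qed.

Lemma test_measurable D : measurable_fun D psi.
Proof.
apply: measurable_funTS; apply: continuous_measurable_fun.
exact: test_continuous.
Qed.

Lemma test_measurable_derive1 D : measurable_fun D psi^`()%classic.
Proof.
by apply: measurable_funTS; apply: continuous_measurable_fun;
  exact: test_continuous_derive1.
Qed.

End one_test_function.

Lemma derivable_continuous_LR f (a b : R) :
  (forall x : R, derivable f x 1) -> derivable_oo_LRcontinuous f a b.
Proof.
move=> df; have cf : continuous f.
  by move=> x; apply/differentiable_continuous/derivable1_diffP/df.
split=> //; first exact/cvg_at_right_filter/cf.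
exact/cvg_at_left_filter/cf.
Qed.

Lemma Rintegral_derive1 f (a b : R) : a <= b ->
  (forall x : R, derivable f x 1) -> continuous f^`()%classic ->
  \int[mu]_(x in `[a, b]) f^`()%classic x = f b - f a.
Proof.
rewrite le_eqVlt => /predU1P[-> df cf|ab df cf].
  by rewrite set_itv1 Rintegral_set1 subrr.
have cf' : {within `[a, b], continuous f^`()%classic}.
  exact: continuous_subspaceT.
have := continuous_FTC2 ab cf' (derivable_continuous_LR f a b df)
  (fun _ _ => erefl).
by rewrite /Rintegral => ->.
Qed.

Lemma Rintegral_Omega f (b0 b1 : bool) : measurable_fun setT f ->
  \int[mu]_(x in [set` Interval (BSide b0 (-1)) (BSide b1 1)]) f x =
  \int[mu]_(x in Omega) f x.
Proof.
move=> mf; rewrite /Rintegral integral_itv_bndoo //.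
by apply/measurable_EFinP; exact: measurable_funTS.
Qed.

Lemma test_weak_derivative v : test_function v ->
  weak_derivative v v^`()%classic.
Proof.
move=> tv psi tpsi.
have m1 : measurable_fun setT (fun x => v x * psi^`()%classic x).
  apply: measurable_funM; first exact: test_measurable.
  exact: test_measurable_derive1.
have m2 : measurable_fun setT (fun x => v^`()%classic x * psi x).
  apply: measurable_funM; first exact: test_measurable_derive1.
  exact: test_measurable.
(* The booleans select the closed interval [-1, 1], on which integration by parts applies; the
   boundary terms vanish. *)
rewrite -(Rintegral_Omega _ true false m1) -(Rintegral_Omega _ true false m2).
rewrite (@Rintegration_by_parts _ v psi v^`()%classic).
- rewrite (test_out v tv 1); last by rewrite /Omega /= in_itv /= ltxx andbF.
  rewrite (test_out v tv (-1)); last by rewrite /Omega /= in_itv /= ltxx.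
  by rewrite !mul0r subrr sub0r.
- lra.
- by apply: continuous_subspaceT; exact: test_continuous_derive1.
- by apply: derivable_continuous_LR; exact: test_derivable.
- by [].
- by apply: continuous_subspaceT; exact: test_continuous_derive1.
- by apply: derivable_continuous_LR; exact: test_derivable.
- by [].
Qed.

(** The mean value theorem and the bounded derivative make [v] Lipschitz; [M + 1] serves as a
    positive constant. *)
Lemma test_abs_continuous v : test_function v -> abs_continuous (-1) 1 v.
Proof.
move=> tv eps e0; have [M M0 hM] := test_derive1_bounded v tv.
have lip x y : x <= y -> `|v y - v x| <= (M + 1) * (y - x).
  move=> xy; have [|||c _ ->] := @MVT_segment _ v v^`()%classic x y.
  - exact: xy.
  - move=> z _; rewrite derive1E; apply: derivableP; exact: test_derivable.
  - by apply: continuous_subspaceT; exact: test_continuous.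
  rewrite normrM (ger0_norm (_ : 0 <= y - x)) ?subr_ge0 //.
  by rewrite ler_wpM2r ?subr_ge0 // (le_trans (hM c)) // lerDl.
have M1 : 0 < M + 1 by rewrite ltr_wpDl.
exists (eps / (M + 1)); first by rewrite divr_gt0.
move=> n x y xy _ h.
apply: (@le_lt_trans _ _ (\sum_(i < n) (M + 1) * (y i - x i))).
  by apply: ler_sum => i _; apply: lip; case: (xy i) => _ [].
by rewrite -mulr_sumr mulrC -ltr_pdivlMr.
Qed.

(** This makes test functions admissible in the weak formulation; the constant sequence serves as
    the approximating one. *)
Lemma test_W01p (p : R) v : 0 < p -> test_function v ->
  W01p p v v^`()%classic.
Proof.
move=> p0 tv; split.
- split.
  + have [M _ hM] := test_bounded v tv.
    exact: LpOmega_bounded p0 (test_measurable v tv _) hM.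
  + have [M _ hM] := test_derive1_bounded v tv.
    exact: LpOmega_bounded p0 (test_measurable_derive1 v tv _) hM.
  + exact: test_weak_derivative.
- exact: test_abs_continuous.
- have Lp0 (g : R -> R) : LpOmega_norm p (g \- g) = 0%E.
    rewrite /LpOmega_norm (_ : EFin \o _ = cst 0%E); last first.
      by apply/funext => x /=; rewrite patchE /= subrr; case: ifP.
    by rewrite Lnorm0 // gt_eqF // lte_fin.
  by exists (fun=> v); split => //; rewrite Lp0; exact: cvg_cst.
Qed.

End TestFunctions.

(** * Smooth ramps, whose derivatives average at a point *)

Section DuBoisReymond.
Context {R : realType}.
Notation mu := (@lebesgue_measure R).
Implicit Types (f F v : R -> R) (a b h x : R).

(** The transition rescaled to [a, a + h]. The affine map is spelled out to match the constructor
    [smooth_affine]. *)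
Definition ramp a h : R -> R := step \o (fun x => h^-1 * x + - (h^-1 * a)).

Lemma smooth_ramp a h : smooth_fun (ramp a h).
Proof. exact: smooth_affine smooth_step. Qed.

Lemma ramp_ge0 a h x : 0 <= ramp a h x. Proof. exact: step_ge0. Qed.

Lemma ramp_le1 a h x : ramp a h x <= 1. Proof. exact: step_le1. Qed.

Lemma ramp_left a h x : 0 < h -> x <= a -> ramp a h x = 0.
Proof.
move=> h0 xa; apply: step_le0; rewrite -mulrBr.
by rewrite mulr_ge0_le0 ?invr_ge0 ?subr_le0 // ltW.
Qed.

Lemma ramp_right a h x : 0 < h -> a + h <= x -> ramp a h x = 1.
Proof.
move=> h0 xa; apply: step_ge1; rewrite -mulrBr mulrC ler_pdivlMr //.
by rewrite mul1r lerBrDl.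
Qed.

Lemma continuous_smooth_fun f : smooth_fun f -> continuous f.
Proof.
move=> sf x; apply/differentiable_continuous/derivable1_diffP.
exact: smooth_fun_derivable.
Qed.

Lemma continuous_derive1_smooth_fun f : smooth_fun f ->
  continuous f^`()%classic.
Proof. by move=> sf; apply/continuous_smooth_fun/smooth_fun_derive1. Qed.

Lemma derive1_ramp a h x :
  (ramp a h)^`()%classic x = step^`()%classic (h^-1 * x + - (h^-1 * a)) * h^-1.
Proof.
have dst : derivable (@step R) (h^-1 * x + - (h^-1 * a)) 1.
  exact: smooth_fun_derivable smooth_step.
have d2 : is_derive x 1 (fun x => h^-1 * x + - (h^-1 * a)) h^-1.
  have := is_deriveD (is_deriveZ h^-1 (is_derive_id x 1))
    (is_derive_cst (- (h^-1 * a)) x 1).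
  by rewrite addr0 [h^-1 *: 1]mulr1.
have [_] := @is_derive1_comp R step _ x _ _ (derivableP dst) d2.
by rewrite !derive1E.
Qed.

Lemma derive1_ramp_out a h x : 0 < h -> (x < a) || (a + h < x) ->
  (ramp a h)^`()%classic x = 0.
Proof.
move=> h0 hx; rewrite derive1_ramp derive1_step_out ?mul0r // -mulrBr.
rewrite pmulr_rlt0 ?invr_gt0 // subr_lt0 mulrC ltr_pdivlMr // mul1r.
by rewrite ltrBrDl.
Qed.

Lemma step_derive1_bounded :
  exists2 K : R, 0 <= K & forall x, `|step^`()%classic x| <= K.
Proof.
have cnf : {within `[(0 : R), 1], continuous (fun x => `|step^`()%classic x|)}.
  apply: continuous_subspaceT => x; apply: continuous_comp.
    exact: continuous_derive1_smooth_fun smooth_step _.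
  exact: norm_continuous.
have [c _ hc] := EVT_max ler01 cnf.
exists `|step^`()%classic c|; first exact: normr_ge0.
move=> x.
have [xin|] := boolP (x \in `[(0:R), 1]); first exact: hc.
rewrite in_itv /= negb_and -!ltNge => /derive1_step_out ->.
by rewrite normr0.
Qed.

(** Both ramps are 0 to the left of [a] and 1 to the right of [b + h], so the support lies in
    [a, b + h]. The derivative is a difference of two kernels of mass one, located near [a] and near
    [b]. *)
Lemma test_function_ramp a b h : 0 < h -> -1 < a -> a < b -> b + h < 1 ->
  test_function (ramp a h - ramp b h).
Proof.
move=> h0 a1 ab b1.
have sv : smooth_fun (ramp a h - ramp b h).
  have -> : ramp a h - ramp b h = ramp a h + cst (-1) * ramp b h.
    apply/funext => x.
    by rewrite -[RHS]/(ramp a h x + (-1 * ramp b h x)) mulN1r.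
  apply: smooth_add; first exact: smooth_ramp.
  by apply: smooth_mul; [exact: smooth_cst | exact: smooth_ramp].
have sub : closure [set x | (ramp a h - ramp b h) x != 0] `<=` `[a, b + h].
  have cl : closed `[a, b + h] by exact: interval_closed.
  rewrite [X in _ `<=` X]((closure_id _).1 cl); apply: closureS => x /=.
  apply: contraR; rewrite in_itv /= negb_and -!ltNge => /orP[xa|xb].
    by rewrite !fctE !ramp_left ?subrr //; [exact/ltW/(lt_trans xa)|exact: ltW].
  rewrite !fctE !ramp_right ?subrr //; first exact: ltW.
  by rewrite (le_trans _ (ltW xb)) // lerD2r ltW.
split; first by move=> n x; exact: smooth_fun_derivable_derive1n.
split.
  apply: subclosed_compact sub; first exact: closed_closure.
  exact: segment_compact.
apply: subset_trans sub _ => x /=; rewrite /Omega /= !in_itv /= => /andP[ax xb].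
by rewrite (lt_le_trans a1 ax) (le_lt_trans xb b1).
Qed.

Lemma smooth_measurable f (D : set R) : smooth_fun f -> measurable_fun D f.
Proof.
move=> sf; apply: measurable_funTS; apply: continuous_measurable_fun.
exact: continuous_smooth_fun.
Qed.

Lemma measurable_derive1_ramp a h (D : set R) :
  measurable_fun D (ramp a h)^`()%classic.
Proof. by apply: smooth_measurable; apply/smooth_fun_derive1/smooth_ramp. Qed.

Lemma derive1_ramp_bounded (K : R) a h x : 0 < h ->
  (forall x, `|step^`()%classic x| <= K) ->
  `|(ramp a h)^`()%classic x| <= K / h.
Proof.
move=> h0 hK; rewrite derive1_ramp normrM ler_pM //.
by rewrite normfV gtr0_norm.
Qed.

Lemma integral_derive1_ramp a h : 0 < h -> -1 <= a -> a + h <= 1 ->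
  \int[mu]_(x in Omega) (ramp a h)^`()%classic x = 1.
Proof.
move=> h0 a1 ah1.
rewrite -(Rintegral_Omega _ true false (measurable_derive1_ramp a h setT)).
rewrite (Rintegral_derive1 (ramp a h) (-1) 1).
- by rewrite ramp_right // ramp_left // subr0.
- lra.
- by move=> x; exact: smooth_fun_derivable (smooth_ramp _ _).
- exact: continuous_derive1_smooth_fun (smooth_ramp _ _).
Qed.

(** The kernel has mass one, so [F a] can be brought inside the integral. It is bounded by [K / h]
    and vanishes off [a, a + h], which lies in the open ball of radius 2h. That ball has measure 4h,
    whence the factor 4K in front of the mean deviation [davg]. *)
Lemma ramp_average_davg (K : R) F a h :
  0 < h -> -1 < a - h - h -> a + h + h < 1 ->
  (forall x, `|step^`()%classic x| <= K) ->
  mu.-integrable Omega (EFin \o F) ->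
  (`|\int[mu]_(x in Omega) (F x * (ramp a h)^`()%classic x) - F a|%:E
     <= (4 * K)%:E * davg (F \_ Omega) a (h + h))%E.
Proof.
move=> h0 a1 a2 hK intF.
have K0 : 0 <= K by apply: le_trans (hK 0).
set r' := (ramp a h)^`()%classic.
have mr' D : measurable_fun D r' by exact: measurable_derive1_ramp.
have br' x : `|r' x| <= K / h by exact: derive1_ramp_bounded.
have intFr : mu.-integrable Omega (EFin \o (fun x => F x * r' x)).
  exact: (integrable_mul_bounded _ _ _ (K / h) measurable_Omega).
have intr : mu.-integrable Omega (EFin \o r').
  by apply: (integrable_itv_bounded _ _ _ _ _ (K / h)).
have intFar : mu.-integrable Omega (EFin \o (fun x => F a * r' x)).
  exact: integrable_scale measurable_Omega intr.
have -> : \int[mu]_(x in Omega) (F x * r' x) - F a =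
    \int[mu]_(x in Omega) ((F x - F a) * r' x).
  rewrite -[F a in LHS]mulr1 -(integral_derive1_ramp a h) //; try lra.
  rewrite -RintegralZl //; last exact: measurable_Omega.
  rewrite -RintegralB //; last exact: measurable_Omega.
  by apply: eq_Rintegral => x _; rewrite mulrBl.
have intd : mu.-integrable Omega (EFin \o (fun x => (F x - F a) * r' x)).
  have := integrable_sub _ _ _ measurable_Omega intFr intFar.
  by under eq_fun do rewrite -mulrBl.
rewrite EFin_normr_Rintegral //; last exact: measurable_Omega.
have := @le_abse_integral _ _ _ mu Omega _ measurable_Omega
  (measurable_int _ intd).
move=> /le_trans; apply.
have ballE : ball a (h + h) = `]a - (h + h), a + (h + h)[%classic.
  by rewrite ball_itv.
have subB : ball a (h + h) `<=` Omega.
  rewrite ballE => x /=; rewrite /Omega /= !in_itv /= => /andP[? ?].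
  by apply/andP; split; lra.
rewrite [leLHS](_ : _ = \int[mu]_(x in ball a (h + h))
    `|((F x - F a) * r' x)%:E|)%E; last first.
  rewrite -[in RHS](setIidr subB) integral_mkcondr; apply: eq_integral => x _.
  rewrite patchE; case: ifPn => // /negP; rewrite inE ballE /= in_itv /= => xB.
  rewrite /r' derive1_ramp_out ?mulr0 //; first by rewrite /= normr0.
  apply/orP; move: xB; case: ltP => /= [_|xa]; last by left; lra.
  by case: ltP => // xa _; right; lra.
have mF : measurable_fun (ball a (h + h)) F.
  apply: (measurable_funS measurable_Omega subB).
  by case/integrableP: intF => /measurable_EFinP.
have gF x : ball a (h + h) x -> (F \_ Omega) x = F x.
  by move=> /subB xO; rewrite patchE mem_set.
rewrite /davg /iavg /= lebesgue_measure_ball ?addr_ge0 ?(ltW h0) // inver.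
have hn0 : (h + h) *+ 2 != 0 by rewrite gt_eqF // mulrn_wgt0 // addr_gt0.
rewrite (negbTE hn0) muleA -EFinM.
have mFa : measurable_fun (ball a (h + h)) (fun x => `|F x - F a|%:E).
  apply/measurable_EFinP/measurableT_comp => //.
  by apply: measurable_funB => //; exact: measurable_cst.
have mB : measurable (ball a (h + h)) by exact: measurable_ball.
apply: (@le_trans _ _
    (\int[mu]_(x in ball a (h + h)) ((K / h)%:E * `|F x - F a|%:E))%E).
  apply: ge0_le_integral => //=.
  - apply/measurable_EFinP/measurableT_comp => //.
    apply: measurable_funM; last exact: mr'.
    by apply: measurable_funB => //; exact: measurable_cst.
  - exact: measurable_funeM.
  - by move=> x _; rewrite -EFinM lee_fin normrM mulrC ler_wpM2r.
rewrite ge0_integralZl_EFin //; last by rewrite divr_ge0 // ltW.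
rewrite le_eqVlt; apply/orP; left; apply/eqP; congr (_ * _)%E.
  congr EFin; have : h != 0 by rewrite gt_eqF.
  by rewrite mulr2n => ?; field; lra.
have aB : ball a (h + h) a by apply: ballxx; rewrite addr_gt0.
by apply: eq_integral => x; rewrite inE => xB; rewrite !gF.
Qed.

End DuBoisReymond.

(** * The weak equation between two Lebesgue points *)

Section WeakPrimitive.
Context {R : realType}.
Notation mu := (@lebesgue_measure R).
Implicit Types (f F v : R -> R) (a b h x : R).

Lemma ramp_average_cvg F a (hs : nat -> R) :
  (forall n, 0 < hs n) -> hs n @[n --> \oo] --> 0 ->
  (forall n, -1 < a - hs n - hs n /\ a + hs n + hs n < 1) ->
  mu.-integrable Omega (EFin \o F) -> lebesgue_pt (F \_ (@Omega R)) a ->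
  \int[mu]_(x in Omega) (F x * (ramp a (hs n))^`()%classic x)
    @[n --> \oo] --> F a.
Proof.
move=> h0 hs0 ha intF /cvge_at_rightP lF.
have [K K0 hK] := @step_derive1_bounded R.
have dv : davg (F \_ (@Omega R)) a (hs n + hs n) @[n --> \oo] --> 0%E.
  apply: (lF (fun n => hs n + hs n)); split => [n|]; first exact: addr_gt0.
  by rewrite -[X in _ --> X]addr0; apply: cvgD.
apply/subr_cvg0/norm_cvg0P.
suff : (`|\int[mu]_(x in Omega) (F x * (ramp a (hs n))^`()%classic x) - F a|%:E)
    @[n --> \oo] --> 0%E by move/fine_cvg.
apply: (@squeeze_cvge _ _ _ _ (cst 0%E) _
  (fun n => (4 * K)%:E * davg (F \_ Omega) a (hs n + hs n))%E).
- apply: nearW => n; rewrite lee_fin normr_ge0 /=.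
  have [h1 h2] := ha n.
  exact: (ramp_average_davg K).
- exact: cvg_cst.
- by rewrite -(mule0 (4 * K)%:E); apply: cvgeZl.
Qed.

(** Each sequence of values is eventually constant. At [x = a] the value is always 0, so the limit
    is the indicator of the open half-line; this is why []a, b]] appears below. *)
Lemma ramp_cvg a x (hs : nat -> R) :
  (forall n, 0 < hs n) -> hs n @[n --> \oo] --> 0 ->
  ramp a (hs n) x @[n --> \oo] --> (if a < x then 1 else 0 : R).
Proof.
move=> h0 hs0; case: ifPn => [ax|]; last first.
  rewrite -leNgt => xa; apply: cvg_near_cst; apply: nearW => n.
  exact: ramp_left.
apply: cvg_near_cst; near=> n.
apply: ramp_right => //; rewrite -lerBrDl; apply: ltW.
by near: n; apply: cvgr_lt hs0 _ _; rewrite subr_gt0.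
Unshelve. all: by end_near. Qed.

(** Test with [ramp a h - ramp b h] and let h tend to 0. The side of [F] tends to [F a - F b] at
    Lebesgue points; the side of [f] converges by dominated convergence, with [|f|] as bound. *)
Lemma weak_primitive F f a b :
  mu.-integrable Omega (EFin \o F) -> mu.-integrable Omega (EFin \o f) ->
  (forall v, test_function v ->
    \int[mu]_(x in Omega) (F x * v^`()%classic x) =
    \int[mu]_(x in Omega) (f x * v x)) ->
  -1 < a -> a < b -> b < 1 ->
  lebesgue_pt (F \_ (@Omega R)) a -> lebesgue_pt (F \_ (@Omega R)) b ->
  F a - F b = \int[mu]_(x in `]a, b]) f x.
Proof.
move=> intF intf H a1 ab b1 La Lb.
(* A third of the smaller distance to the boundary: ramps of width at most [d] keep two widths on
   either side of [a] and [b] strictly inside [Omega]. *)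
pose d := Num.min (a + 1) (1 - b) / 3.
have da : 3 * d <= a + 1.
  by rewrite /d mulrC divfK ?ge_min ?lexx.
have db : 3 * d <= 1 - b.
  by rewrite /d mulrC divfK ?ge_min ?lexx ?orbT.
have d0 : 0 < d by rewrite divr_gt0 // lt_min; apply/andP; split; lra.
pose hs n : R := d * harmonic n.
have hs0 n : 0 < hs n by rewrite mulr_gt0 //= harmonic_gt0.
have hsd n : hs n <= d.
  by rewrite ger_pMr // invf_le1 ?ler1n ?ltr0n.
have hsc : hs n @[n --> \oo] --> 0.
  by rewrite -(mulr0 d); apply: cvgMr; exact: cvg_harmonic.
pose v n := ramp a (hs n) - ramp b (hs n).
have tv n : test_function (v n).
  by apply: test_function_ramp => //; have := hsd n; lra.
have [K K0 hK] := @step_derive1_bounded R.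
have intFr c n : mu.-integrable Omega
    (EFin \o (fun x => F x * (ramp c (hs n))^`()%classic x)).
  apply: (integrable_mul_bounded _ _ _ (K / hs n) measurable_Omega) => //.
    exact: measurable_derive1_ramp.
  by move=> x _; exact: derive1_ramp_bounded.
have Hn n : \int[mu]_(x in Omega) (f x * v n x) =
    \int[mu]_(x in Omega) (F x * (ramp a (hs n))^`()%classic x) -
    \int[mu]_(x in Omega) (F x * (ramp b (hs n))^`()%classic x).
  rewrite -H // -RintegralB //; last exact: measurable_Omega.
  apply: eq_Rintegral => x _; rewrite -mulrBr; congr (_ * _).
  rewrite !derive1E deriveB //;
    exact: smooth_fun_derivable (smooth_ramp _ _).
have lhs : \int[mu]_(x in Omega) (f x * v n x) @[n --> \oo] --> F a - F b.
  under eq_fun do rewrite Hn.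
  by apply: cvgB; apply: ramp_average_cvg => // n; have := hsd n;
    have := hs0 n; split; lra.
have rhs : \int[mu]_(x in Omega) (f x * v n x) @[n --> \oo] -->
    \int[mu]_(x in `]a, b]) f x.
  have sub : `]a, b] `<=` @Omega R.
    move=> x; rewrite /Omega /= !in_itv /= => /andP[? ?].
    by apply/andP; split; lra.
  have mf : measurable_fun Omega f.
    by case/integrableP: intf => /measurable_EFinP.
  have mfv n : measurable_fun Omega (fun x => f x * v n x).
    by apply: measurable_funM => //; exact: test_measurable.
  have mI : measurable `]a, b] by exact: measurable_itv.
  have vn n x : `|v n x| <= 1.
    rewrite /v !fctE; have := ramp_ge0 a (hs n) x; have := ramp_le1 a (hs n) x.
    have := ramp_ge0 b (hs n) x; have := ramp_le1 b (hs n) x.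
    by rewrite ler_norml => *; apply/andP; split; lra.
  have [|||||ifI _] := @dominated_convergence _ _ _ mu Omega measurable_Omega
    (fun n x => (f x * v n x)%:E) (EFin \o (f \_ `]a, b])) (fun x => `|f x|%:E).
  - move=> n; apply/measurable_EFinP; exact: mfv.
  - apply/measurable_EFinP.
    apply: (measurable_restrict f mI measurable_Omega).1.
    by apply: (measurable_funS measurable_Omega _ mf); exact: subIsetl.
  - apply: aeW => x Ox; apply: cvg_EFin; first exact: nearW.
    rewrite [X in _ --> X](_ : _ =
        f x * ((if a < x then 1 else 0) - (if b < x then 1 else 0))).
      apply: cvgM; first exact: cvg_cst.
      by apply: cvgB; exact: ramp_cvg.
    rewrite /= patchE mem_setE in_itv /=.
    case: (ltP a x) => ax; case: (ltP b x) => bx /=;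
      rewrite ?subrr ?subr0 ?mulr0 ?mulr1 //.
    by exfalso; lra.
  - exact: integrable_norm.
  - apply: aeW => x n _; rewrite lee_fin normrM -[leRHS]mulr1.
    exact: ler_wpM2l.
  have -> : \int[mu]_(x in `]a, b]) f x =
      \int[mu]_(x in Omega) (f \_ `]a, b]) x.
    by rewrite -Rintegral_mkcondr setIidr.
  have fin := @integrable_fin_num _ _ _ mu Omega measurable_Omega _ ifI.
  by rewrite -[X in _ --> X -> _]fineK // => /fine_cvg.
exact: (cvg_unique _ lhs rhs).
Unshelve. all: by end_near. Qed.

End WeakPrimitive.

(** * From almost everywhere to everywhere, and the du Bois-Reymond lemma *)

Section ContinuousRepresentatives.
Context {R : realType}.
Notation mu := (@lebesgue_measure R).
Implicit Types (f F g u U : R -> R) (a b x : R).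

(** Otherwise the interval would be negligible, against its positive length. This extracts actual
    points from almost everywhere statements. *)
Lemma ae_exists_itv (Q : R -> Prop) a b : a < b ->
  {ae mu, forall x, Q x} -> exists2 x, a < x < b & Q x.
Proof.
move=> ab aeQ; apply: contrapT => nQ.
have neg : mu.-negligible `]a, b[%classic.
  apply: negligibleS aeQ => x /=; rewrite in_itv /= => xab Qx.
  by apply: nQ; exists x.
have := @measure_negligible _ _ _ mu `]a, b[%classic (measurable_itv _) neg.
rewrite /= lebesgue_measure_itv /= lte_fin ab -EFinD => -[] /eqP.
by rewrite subr_eq0 gt_eqF.
Qed.

Lemma within_continuous_dist f a b x (e : R) :
  {within `[a, b], continuous f} -> a <= x <= b -> 0 < e ->
  exists2 d : R, 0 < d &
    forall y, a <= y <= b -> `|x - y| < d -> `|f x - f y| < e.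
Proof.
move=> /subspace_continuousP cf xab e0.
have /cvgrPdist_lt/(_ _ e0) := cf x xab.
rewrite /prop_near1 /within /= => /nbhs_ballP[d /= d0 hd].
by exists d => // y yab xy; exact: hd.
Qed.

(** If the values differed at [x], continuity would keep them apart near [x]. The part of that
    neighbourhood inside ]a, b[ has positive length even when [x] is an endpoint, and so contains a
    point of equality. *)
Lemma eq_continuous_ae f g a b : a < b ->
  {within `[a, b], continuous f} -> {within `[a, b], continuous g} ->
  {ae mu, forall x, a < x < b -> f x = g x} ->
  forall x, a <= x <= b -> f x = g x.
Proof.
move=> ab cf cg fg x xab; apply/eqP/negPn/negP => fgx.
pose e := `|f x - g x| / 2.
have e0 : 0 < e by rewrite divr_gt0 // normr_gt0 subr_eq0.
have [d1 d10 h1] := within_continuous_dist f a b x e cf xab e0.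
have [d2 d20 h2] := within_continuous_dist g a b x e cg xab e0.
pose d := Num.min d1 d2.
have d0 : 0 < d by rewrite lt_min d10 d20.
move: (xab) => /andP[ax xb].
have lr : Num.max a (x - d) < Num.min b (x + d).
  by rewrite gt_max !lt_min; apply/andP; split; apply/andP; split; lra.
have [y /andP[]] := ae_exists_itv _ _ _ lr fg.
rewrite gt_max lt_min => /andP[ay dy] /andP[yb yd] fgy.
have yab : a <= y <= b by rewrite !ltW.
have : `|x - y| < d by rewrite ltr_norml; apply/andP; split; lra.
rewrite lt_min => /andP[xy1 xy2].
have := h1 _ yab xy1; have := h2 _ yab xy2; rewrite fgy ?ay //.
have := ler_normD (f x - g y) (g y - g x).
rewrite addrA subrK distrC [`|g y - g x|]distrC /e.
by rewrite distrC; lra.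
Qed.

Lemma abs_continuous_within u a b : abs_continuous a b u ->
  {within `[a, b], continuous u}.
Proof.
move=> acu; apply/subspace_continuousP => x xab.
apply/cvgrPdist_lt => e e0; have [d d0 hd] := acu e e0.
have key y z : a <= y -> y <= z -> z <= b -> z - y < d -> `|u z - u y| < e.
  move=> ay yz zb zy; have := hd 1%N (fun=> y) (fun=> z).
  rewrite !big_ord1; apply => //.
  by move=> i j _ _ _; rewrite (ord1 i) (ord1 j).
rewrite /prop_near1 /within /=; apply/nbhs_ballP; exists d => //= y xy yab.
move: xab yab xy; rewrite /= !in_itv /= /ball /= => /andP[ax xb] /andP[ay yb].
rewrite ltr_norml => /andP[xy1 xy2].
have [xy|yx] := leP x y.
  by rewrite distrC; apply: key => //; lra.
by apply: key => //; lra.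
Qed.

Lemma integrable_itv_oo_cc g a b : mu.-integrable `]a, b[ (EFin \o g) ->
  mu.-integrable `[a, b] (EFin \o g).
Proof.
move=> /integrableP[/measurable_EFinP mg ig]; apply/integrableP; split.
  by apply/measurable_EFinP; exact: (measurable_fun_itv_cc mg).
rewrite integral_itv_bndoo //.
by apply/measurable_EFinP; apply: measurableT_comp.
Qed.

Lemma integral_continuous g a b : a <= b ->
  mu.-integrable `]a, b[ (EFin \o g) ->
  {within `[a, b], continuous (fun x => \int[mu]_(t in `]a, x]) g t)}.
Proof.
move=> ab /integrable_itv_oo_cc intg.
have := parameterized_integral_continuous ab intg.
apply: subspace_eq_continuous => x; rewrite inE /= in_itv /= => /andP[ax xb].
rewrite /from_subspace /parameterized_integral Rintegral_itv_obnd_cbnd //.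
apply: integrableS intg => //; apply: subset_itv; rewrite bnd_simp //.
Qed.

(** Almost every point is a Lebesgue point of [F]. One of them is fixed as reference and compared
    with all the others, which determines [c]. *)
Lemma weak_primitive_ae F f :
  mu.-integrable Omega (EFin \o F) -> mu.-integrable Omega (EFin \o f) ->
  (forall v, test_function v ->
    \int[mu]_(x in Omega) (F x * v^`()%classic x) =
    \int[mu]_(x in Omega) (f x * v x)) ->
  exists c : R, {ae mu, forall x, Omega x ->
    F x = c - \int[mu]_(t in `]-1, x]) f t}.
Proof.
move=> intF intf H.
have /lebesgue_differentiation aeL :=
  integrable_locally_restrict measurable_Omega intF.
have [a /andP[a1 a2] La] := ae_exists_itv _ (-1) 1 ltac:(lra) aeL.
exists (F a + \int[mu]_(t in `]-1, a]) f t).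
have intf1 c : c < 1 -> mu.-integrable `]-1, c] (EFin \o f).
  move=> c1; apply: integrableS intf => //; first exact: measurable_Omega.
  by move=> x; rewrite /Omega /= !in_itv /= => /andP[-> /le_lt_trans]; apply.
have split b c : -1 < b -> b <= c -> c < 1 ->
    \int[mu]_(t in `]-1, c]) f t - \int[mu]_(t in `]-1, b]) f t =
    \int[mu]_(t in `]b, c]) f t.
  by move=> b1 bc c1; rewrite (Rintegral_itvB (intf1 _ c1)) // bnd_simp // ltW.
move: aeL; apply: filterS; first exact: (ae_filter_ringOfSetsType mu).
move=> x Lx; rewrite /Omega /= in_itv /= => /andP[x1 x2].
have [xa|ax|->] := ltgtP x a.
- have := weak_primitive F f x a intF intf H x1 xa a2 Lx La.
  by rewrite -split //; [lra | exact: ltW].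
- have := weak_primitive F f a x intF intf H a1 ax x2 La Lx.
  by rewrite -split //; [lra | exact: ltW].
- by rewrite addrK.
Qed.

End ContinuousRepresentatives.

(** * Sobolev functions as primitives of their weak derivatives *)

Section SobolevRepresentatives.
Context {R : realType}.
Notation mu := (@lebesgue_measure R).
Implicit Types (g u du : R -> R) (p x : R).

Lemma LpOmega_measurable p g : LpOmega p g -> measurable_fun Omega g.
Proof.
rewrite /LpOmega inE => /andP[]; rewrite inE /= => mg _.
exact: (measurable_restrictT g measurable_Omega).2.
Qed.

(** Hoelder's inequality against the indicator of [Omega], whose norm for the conjugate exponent [q]
    is the constant. *)
Lemma integral_le_LpOmega_norm p : 1 < p ->
  exists2 C : R, 0 <= C & forall g, measurable_fun Omega g ->
    (\int[mu]_(x in @Omega R) `|g x|%:E <= C%:E * LpOmega_norm p g)%E.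
Proof.
move=> p1; have p0 : 0 < p by lra.
pose q := p / (p - 1).
have q0 : 0 < q by rewrite divr_gt0 // subr_gt0.
have pq : p^-1 + q^-1 = 1 by rewrite /q; field; apply/andP; split; lra.
pose N := 'N[mu]_(q%:E)[EFin \o ((cst (1%R : R)) \_ (@Omega R))]%E.
have Nfin : N \is a fin_num.
  have : LpOmega q (cst (1 : R)).
    by apply: (LpOmega_bounded _ _ 1) => // x; rewrite normr1.
  rewrite /LpOmega inE => /andP[_]; rewrite inE /= /finite_norm -/N => Nlt.
  by rewrite ge0_fin_numE // Lnorm_ge0.
exists (fine N); first by rewrite fine_ge0 // Lnorm_ge0.
move=> g mg; rewrite fineK // muleC.
have mg' : measurable_fun setT (g \_ (@Omega R)).
  exact: (measurable_restrictT g measurable_Omega).1.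
have m1 : measurable_fun setT (cst (1 : R) \_ (@Omega R)).
  exact: measurable_restrict_Omega.
have := hoelder mu mg' m1 p0 q0 pq.
apply: le_trans; rewrite Lnorm1 [leLHS]integral_mkcond le_eqVlt.
apply/orP; left; apply/eqP; apply: eq_integral => x _.
rewrite !patchE /= !patchE.
by case: ifPn => _; rewrite ?mulr1 ?mulr0 ?normr0.
Qed.

Lemma LpOmega_integrable p g : 1 < p -> LpOmega p g ->
  mu.-integrable Omega (EFin \o g).
Proof.
move=> p1 Lg; have mg := LpOmega_measurable _ _ Lg.
have [C C0 hC] := integral_le_LpOmega_norm p p1.
apply/integrableP; split; first exact/measurable_EFinP.
apply: le_lt_trans (hC g mg) _.
move: Lg; rewrite /LpOmega inE => /andP[_]; rewrite inE /= /finite_norm.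
by move=> Lfin; rewrite lte_mul_pinfty.
Qed.

Lemma test_primitive (psi : R -> R) x : test_function psi -> -1 <= x ->
  psi x = \int[mu]_(t in `]-1, x]) psi^`()%classic t.
Proof.
move=> tpsi x1; rewrite Rintegral_itv_obnd_cbnd; last first.
  have [M _ hM] := test_derive1_bounded psi tpsi.
  by apply: (integrable_itv_bounded _ _ _ _ _ M) => //;
    exact: test_measurable_derive1.
rewrite Rintegral_derive1 //.
- by rewrite (test_out _ tpsi (-1)) ?subr0 // /Omega /= in_itv /= ltxx.
- by move=> y; exact: test_derivable.
- exact: test_continuous_derive1.
Qed.

(** The approximating [psi n] are primitives of their derivatives, which converge to [du] in L^1;
    hence they converge uniformly to the primitive [U] of [du]. They also converge to [u] in L^1, so
    [u = U] almost everywhere, then everywhere by continuity. The value at 1 is the limit of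
    [psi n 1 = 0]. *)
Lemma W01p_primitive p u du : 1 < p -> W01p p u du ->
  (forall x, -1 <= x <= 1 -> u x = \int[mu]_(t in `]-1, x]) du t) /\ u 1 = 0.
Proof.
move=> p1 [[Lu Ldu _] acu [psi [tpsi cvu cvdu]]].
have [C C0 hC] := integral_le_LpOmega_norm p p1.
have intdu : mu.-integrable Omega (EFin \o du) := LpOmega_integrable _ _ p1 Ldu.
pose U x := \int[mu]_(t in `]-1, x]) du t.
pose e n : R -> R := fun t => (psi n)^`()%classic t - du t.
have intd n : mu.-integrable Omega (EFin \o e n).
  apply: integrable_sub => //; first exact: measurable_Omega.
  have [M _ hM] := test_derive1_bounded (psi n) (tpsi n).
  by apply: (integrable_itv_bounded _ _ _ _ _ M) => //;
    exact: test_measurable_derive1.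
have close n x : -1 <= x <= 1 ->
    (`|psi n x - U x|%:E <= C%:E * LpOmega_norm p (e n))%E.
  move=> /andP[x1 x2].
  have mdiff : measurable_fun Omega (e n).
    by case/integrableP: (intd n) => /measurable_EFinP.
  apply: le_trans (hC _ mdiff).
  have sub : `]-1, x] `<=` (`[-1, 1] : set R).
    by apply: subset_itv; rewrite bnd_simp.
  have intcc := integrable_itv_oo_cc _ _ _ (intd n).
  have intx : mu.-integrable `]-1, x] (EFin \o e n).
    exact: integrableS intcc.
  have intdux : mu.-integrable `]-1, x] (EFin \o du).
    by apply: integrableS (@integrable_itv_oo_cc R du _ _ intdu).
  have intpx : mu.-integrable `]-1, x] (EFin \o (psi n)^`()%classic).
    have [M _ hM] := test_derive1_bounded (psi n) (tpsi n).
    by apply: (integrable_itv_bounded _ _ _ _ _ M) => //;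
      exact: test_measurable_derive1.
  rewrite (test_primitive _ _ (tpsi n)) // /U -RintegralB //.
  rewrite EFin_normr_Rintegral //.
  have := @le_abse_integral _ _ _ mu `]-1, x] _ (measurable_itv _)
    (measurable_int _ intx).
  move=> /le_trans; apply.
  rewrite /Omega -(@integral_itv_bndoo _ _ _ _ true false); last first.
    by apply/measurable_EFinP; apply: measurableT_comp.
  apply: ge0_subset_integral => //=.
  by apply/measurable_EFinP; apply: measurableT_comp => //;
    case/integrableP: intcc => /measurable_EFinP.
have cvC : (C%:E * LpOmega_norm p (e n))%E @[n --> \oo] --> 0%E.
  by rewrite -(mule0 C%:E); apply: cvgeZl.
have U1 : U 1 = 0.
  have : (`|U 1|%:E <= 0)%E.
    apply: cvge_ge cvC; apply: nearW => n; have := close n 1.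
    rewrite (test_out _ (tpsi n) 1) ?sub0r ?normrN; last first.
      by rewrite /Omega /= in_itv /= ltxx andbF.
    by apply; rewrite lexx andbT; lra.
  by rewrite lee_fin normr_le0 => /eqP.
suff uU : forall x, -1 <= x <= 1 -> u x = U x.
  split => //; rewrite uU // lexx andbT; lra.
apply: eq_continuous_ae; first lra.
- exact: abs_continuous_within.
- by apply: integral_continuous => //; lra.
have cU : {within `[-1, 1], continuous U}.
  by apply: integral_continuous => //; lra.
have mU : measurable_fun Omega U.
  have mcc := subspace_continuous_measurable_fun
    (measurable_itv `[(-1 : R), 1]) cU.
  by apply: measurable_funS mcc => //; exact: subset_itv_oo_cc.
have mu' : measurable_fun Omega u := LpOmega_measurable _ _ Lu.
have mdu n : measurable_fun Omega (psi n \- u).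
  by apply: measurable_funB => //; exact: test_measurable.
pose c n := (C%:E * LpOmega_norm p (e n))%E.
have c0 n : (0 <= c n)%E by rewrite mule_ge0 // Lnorm_ge0.
(* The triangle inequality through [psi n], with the uniform bound [c n] on the distance from
   [psi n] to [U]. *)
have bound n : (\int[mu]_(x in @Omega R) `|(u \- U) x|%:E <=
    C%:E * LpOmega_norm p (psi n \- u)%R + c n * mu (@Omega R))%E.
  apply: (@le_trans _ _ (\int[mu]_(x in @Omega R)
      (`|(psi n \- u) x|%:E + c n))%E).
    apply: ge0_le_integral => //=.
    - exact: measurable_Omega.
    - apply/measurable_EFinP; apply: measurableT_comp => //.
      exact: measurable_funB.
    - apply: emeasurable_funD; last exact: measurable_cst.
      by apply/measurable_EFinP; apply: measurableT_comp => //; exact: mdu.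
    - move=> x; rewrite /Omega /= in_itv /= => /andP[x1 x2].
      have h := close n x; move: h; rewrite (ltW x1) (ltW x2) => /(_ isT) h.
      apply: le_trans (leeD (lexx _) h); rewrite -EFinD lee_fin.
      rewrite -[`|psi n x - u x|]normrN opprB.
      by apply: le_trans (ler_normD _ _); rewrite addrA subrK.
  rewrite ge0_integralD //=; last 2 first.
  - exact: measurable_Omega.
  - by apply/measurable_EFinP; apply: measurableT_comp => //; exact: mdu.
  rewrite integral_cst /=; last exact: measurable_Omega.
  by apply: leeD => //; exact: (hC (psi n \- u)).
have cvbound : (C%:E * LpOmega_norm p (psi n \- u)%R + c n * mu (@Omega R))%E
    @[n --> \oo] --> 0%E.
  rewrite -[X in _ --> X]adde0; apply: cvgeD => //.
    by rewrite -(mule0 C%:E); apply: cvgeZl.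
  rewrite /Omega /= lebesgue_measure_itv /= lte_fin ifT; last lra.
  by rewrite -[X in _ --> X](mul0e (1 - -1)%:E); apply: cvgeZr.
have I0 : (\int[mu]_(x in @Omega R) `|(u \- U) x|%:E)%E = 0%E.
  apply/eqP; rewrite eq_le integral_ge0 // andbT.
  by apply: cvge_ge cvbound; exact: nearW.
have muU : measurable_fun Omega (EFin \o (u \- U)).
  by apply/measurable_EFinP; exact: measurable_funB.
have := (@ae_eq_integral_abs _ _ _ mu Omega measurable_Omega _ muU).1 I0.
rewrite /ae_eq; apply: filterS.
move=> x h xO; have : Omega x by rewrite /Omega /= in_itv.
by move=> /h /= [] /eqP; rewrite subr_eq0 => /eqP.
Qed.

End SobolevRepresentatives.

(** * Integral inequalities, backward Gronwall, first and last zeros *)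

Section IntegralInequalities.
Context {R : realType}.
Notation mu := (@lebesgue_measure R).
Implicit Types (f g v dv : R -> R) (a b x k : R).

Lemma ae_imp (A B : R -> Prop) : (forall x, A x -> B x) ->
  {ae mu, forall x, A x} -> {ae mu, forall x, B x}.
Proof.
by move=> AB; apply: filterS; first exact: (ae_filter_ringOfSetsType mu).
Qed.

Lemma ae_imp2 (A B C : R -> Prop) : (forall x, A x -> B x -> C x) ->
  {ae mu, forall x, A x} -> {ae mu, forall x, B x} -> {ae mu, forall x, C x}.
Proof.
by move=> ABC; apply: filterS2; first exact: (ae_filter_ringOfSetsType mu).
Qed.

(** The difference [g - f] agrees almost everywhere with its absolute value, whose integral is
    nonnegative. *)
Lemma le_ae_Rintegral (D : set R) f g : measurable D ->
  mu.-integrable D (EFin \o f) -> mu.-integrable D (EFin \o g) ->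
  {ae mu, forall x, D x -> f x <= g x} ->
  \int[mu]_(x in D) f x <= \int[mu]_(x in D) g x.
Proof.
move=> mD intf intg fg; rewrite -subr_ge0 -RintegralB //.
have intgf := integrable_sub D g f mD intg intf.
have mgf : measurable_fun D (fun x => g x - f x).
  by case/integrableP: intgf => /measurable_EFinP.
rewrite /Rintegral
  (@ae_eq_integral _ _ _ mu D (EFin \o (fun x => `|g x - f x|))) //.
- by rewrite fine_ge0 // integral_ge0 // => x _; rewrite lee_fin.
- exact/measurable_EFinP.
- by apply/measurable_EFinP; exact: measurableT_comp.
- apply: ae_imp fg => x h Dx /=.
  by rewrite ger0_norm // subr_ge0 h.
Qed.

Lemma Rintegral_itv_oc_oo g a b : measurable_fun `]a, b[ g ->
  \int[mu]_(x in `]a, b]) g x = \int[mu]_(x in `]a, b[) g x.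
Proof.
by move=> mg; rewrite /Rintegral integral_itv_bndoo //; exact/measurable_EFinP.
Qed.

Lemma le_ae_Rintegral_itv f g a b :
  mu.-integrable `]a, b[ (EFin \o f) -> mu.-integrable `]a, b[ (EFin \o g) ->
  {ae mu, forall x, a < x < b -> f x <= g x} ->
  \int[mu]_(x in `]a, b]) f x <= \int[mu]_(x in `]a, b]) g x.
Proof.
move=> intf intg fg; rewrite !Rintegral_itv_oc_oo.
- exact: le_ae_Rintegral.
- by case/integrableP: intg => /measurable_EFinP.
- by case/integrableP: intf => /measurable_EFinP.
Qed.

Lemma ae_eq0_of_Rintegral_le0 g a b : a <= b ->
  mu.-integrable `]a, b[ (EFin \o g) ->
  {ae mu, forall x, a < x < b -> 0 <= g x} ->
  \int[mu]_(x in `]a, b]) g x <= 0 ->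
  {ae mu, forall x, a < x < b -> g x = 0}.
Proof.
move=> ab intg g0 Ig.
have mg : measurable_fun `]a, b[ g.
  by case/integrableP: intg => /measurable_EFinP.
have I0 : (\int[mu]_(x in `]a, b[) `|g x|%:E = 0)%E.
  rewrite (@ae_eq_integral _ _ _ mu `]a, b[ (EFin \o g)) //=.
  - have fin := @integrable_fin_num _ _ _ mu _ (measurable_itv `]a, b[) _ intg.
    have Eb : \int[mu]_(x in `]a, b]) g x = \int[mu]_(x in `]a, b[) g x.
      exact: Rintegral_itv_oc_oo.
    have I0 : 0 <= \int[mu]_(x in `]a, b[) g x.
      have <- : \int[mu]_(x in `]a, b[) (0 : R) = 0.
        by rewrite Rintegral_cst // mul0r.
      by apply: le_ae_Rintegral => //; exact: integrable0.
    have I1 : \int[mu]_(x in `]a, b[) g x = 0.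
      by apply/eqP; rewrite eq_le I0 -Eb Ig.
    by rewrite -(fineK fin); congr EFin.
  - by apply/measurable_EFinP; exact: measurableT_comp.
  - exact/measurable_EFinP.
  - apply: ae_imp g0 => x h; rewrite /= in_itv /= => xab.
    by rewrite ger0_norm // h.
have mgE : measurable_fun `]a, b[ (EFin \o g) by exact/measurable_EFinP.
have := (@ae_eq_integral_abs _ _ _ mu _ (measurable_itv `]a, b[) _ mgE).1 I0.
apply: ae_imp => x h xab; have : x \in `]a, b[ by rewrite in_itv.
by move=> /h /= [].
Qed.

(** Put W(x) = exp(kx) times the integral of [v] over [x, b]. The hypothesis says exactly that W' >=
    0, and W(b) = 0; so that integral is nonpositive, which squeezes [v] to 0. *)
Lemma gronwall_backward v k a b : 0 <= k -> a <= b ->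
  {within `[a, b], continuous v} ->
  (forall x, a <= x <= b -> 0 <= v x <= k * \int[mu]_(t in `]x, b]) v t) ->
  forall x, a <= x <= b -> v x = 0.
Proof.
move=> k0; rewrite le_eqVlt => /predU1P[<- _ hv x|ab cv hv].
  (* For [a = b] the integral runs over the empty interval []a, a]]. *)
  rewrite -eq_le => /eqP <-; have := hv a; rewrite lexx => /(_ isT).
  by rewrite set_itv_ge ?bnd_simp // Rintegral_set0 mulr0 -eq_le => /eqP.
have intv : mu.-integrable `[a, b] (EFin \o v).
  by apply: continuous_compact_integrable => //; exact: segment_compact.
pose P x := \int[mu]_(t in `[a, x]) v t.
have cP : {within `[a, b], continuous P}.
  exact: parameterized_integral_continuous (ltW ab) intv.
have vP x : a <= x <= b -> \int[mu]_(t in `]x, b]) v t = P b - P x.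
  move=> /andP[ax xb].
  by rewrite /P (Rintegral_itvB intv) // bnd_simp.
pose W x := expR (k * x) * (P b - P x).
have dP x : x \in `]a, b[ -> is_derive x 1 P (v x).
  rewrite in_itv /= => /andP[ax xb].
  have [cin _ _] := (continuous_within_itvP v ab).1 cv.
  have cvx : {for x, continuous v} by apply: cin; rewrite in_itv /= ax.
  have [derP derPE] := @continuous_FTC1_closed R v a x b xb intv ax cvx.
  by apply: (DeriveDef derP); rewrite -derive1E; exact: derPE.
have dW x : x \in `]a, b[ -> is_derive x 1 W
    (expR (k * x) * (k * (P b - P x) - v x)).
  move=> xab; have dPx := dP x xab.
  have dk : is_derive x 1 (fun y : R => k * y) k.
    by have := is_deriveZ k (is_derive_id x 1); rewrite [k *: 1]mulr1.
  have dE : is_derive x 1 (expR \o (fun y : R => k * y)) (expR (k * x) * k).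
    by apply: is_derive1_comp.
  have dD := is_deriveB (is_derive_cst (P b) x 1) dPx.
  apply: is_derive_eq (is_deriveM dE dD) _.
  rewrite -[LHS]/(expR (k * x) * (0 - v x) + (P b - P x) * (expR (k * x) * k)).
  ring.
have cW : {within `[a, b], continuous W}.
  have cE : {within `[a, b], continuous (fun y : R => expR (k * y))}.
    apply: continuous_subspaceT => y; apply: continuous_comp.
      exact: mulrl_continuous.
    exact: continuous_expR.
  apply/subspace_continuousP => y yab.
  apply: cvgM; first by move/subspace_continuousP: cE; apply.
  by apply: cvgB; [exact: cvg_cst | move/subspace_continuousP: cP; apply].
have W0 x : a <= x <= b -> P b - P x <= 0.
  move=> /andP[ax xb].
  have : W x <= W b.
    apply: (@ger0_derive1_ndecr R W a b); last exact: lexx; last exact: xb;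
      last exact: ax; last exact: cW.
    - by move=> y yab; case: (dW y yab).
    - move=> y yab; have := dW y yab; rewrite derive1E => -[_ ->].
      apply: mulr_ge0; first exact: expR_ge0.
      move: yab; rewrite in_itv /= => /andP[ay yb].
      have yab : a <= y <= b by rewrite !ltW.
      by have /andP[_] := hv y yab; rewrite vP // subr_ge0.
  by rewrite /W subrr mulr0 pmulr_rle0 // expR_gt0.
move=> x xab; have /andP[v0 vk] := hv x xab.
apply/eqP; rewrite eq_le v0 andbT (le_trans vk) //.
by rewrite vP // mulr_ge0_le0 // W0.
Qed.

(** The zero is the infimum of the points where [f >= 0]. Continuity is stated with epsilon and
    delta so that it passes easily to the reflected function x -> f(-x), from which [last_zero]
    follows. *)
Lemma first_zero f a b : (forall x (e : R), a <= x <= b -> 0 < e ->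
    exists2 d : R, 0 < d & forall y, a <= y <= b -> `|x - y| < d ->
      `|f x - f y| < e) ->
  a <= b -> f a < 0 -> f b = 0 ->
  exists y, [/\ a < y, y <= b, f y = 0 & forall x, a <= x < y -> f x < 0].
Proof.
move=> cf ab fa fb.
pose A := [set x | a <= x <= b /\ 0 <= f x].
have Ab : A b by split; rewrite ?ab ?lexx // fb.
have hi : has_inf A by split; [exists b | exists a => x [/andP[]]].
have lbA x : A x -> inf A <= x by move=> Ax; exact: (ge_inf hi.2).
have am : a <= inf A by apply: lb_le_inf => [|x [/andP[]]]; first by exists b.
have mb : inf A <= b by exact: lbA.
have mab : a <= inf A <= b by rewrite am mb.
have neg x : a <= x < inf A -> f x < 0.
  move=> /andP[ax xm]; rewrite ltNge; apply/negP => fx.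
  have := lbA x; rewrite leNgt xm => /(_ _)/negP; apply=> //.
  by split => //; rewrite ax (le_trans (ltW xm)).
have fm0 : 0 <= f (inf A).
  rewrite leNgt; apply/negP => fm.
  have [d d0 hd] := cf (inf A) (- f (inf A)) mab ltac:(lra).
  have [x Ax xd] := inf_adherent d0 hi.
  have xm := lbA x Ax.
  have h := hd x Ax.1.
  have /h : `|inf A - x| < d by rewrite ltr_norml; apply/andP; split; lra.
  by case: Ax => _ fx; rewrite ltr_norml => /andP[]; lra.
have amlt : a < inf A.
  by rewrite lt_neqAle am andbT; apply/eqP => E; move: fm0; rewrite -E; lra.
exists (inf A); split => //.
apply/eqP; rewrite eq_le fm0 andbT leNgt; apply/negP => fm.
have [d d0 hd] := cf (inf A) (f (inf A)) mab fm.
(* A point left of the infimum, where [f] is negative, yet close enough for continuity to force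
   [f x > 0]. *)
pose x := Num.max a (inf A - d / 2).
have ax : a <= x by rewrite le_max lexx.
have xm : x < inf A by rewrite gt_max amlt /=; lra.
have xd : inf A - d / 2 <= x by rewrite le_max lexx orbT.
have xab : a <= x <= b by rewrite ax; lra.
have fx : f x < 0 by apply: neg; rewrite ax.
have : `|inf A - x| < d by rewrite ltr_norml; apply/andP; split; lra.
by move=> /(hd x xab); rewrite ltr_norml => /andP[]; lra.
Qed.

Lemma last_zero f a b : (forall x (e : R), a <= x <= b -> 0 < e ->
    exists2 d : R, 0 < d & forall y, a <= y <= b -> `|x - y| < d ->
      `|f x - f y| < e) ->
  a <= b -> f a = 0 -> f b < 0 ->
  exists y, [/\ a <= y, y < b, f y = 0 & forall x, y < x <= b -> f x < 0].
Proof.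
move=> cf ab fa fb.
have opp_itv x : - b <= x <= - a -> a <= - x <= b.
  by move=> /andP[? ?]; apply/andP; split; lra.
have [||||y [y1 y2 y3 y4]] := @first_zero (fun x => f (- x)) (- b) (- a).
- move=> x e /opp_itv xab e0; have [d d0 hd] := cf (- x) e xab e0.
  exists d => // z /opp_itv zab xz; apply: hd => //.
  by rewrite -opprD normrN.
- by rewrite lerN2.
- by rewrite opprK.
- by rewrite opprK.
exists (- y); split => //; try lra.
move=> x /andP[yx xb]; rewrite -(opprK x); apply: y4.
by apply/andP; split; lra.
Qed.

End IntegralInequalities.

(** * Pointwise consequences of one-sided bounds on the flux, with [r = p - 2] *)

Section FluxInequalities.
Context {R : realType}.
Implicit Types (r H S u s : R).

Let powR_norm_gt0 r s : 0 < s -> 0 < `|s| `^ r.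
Proof. by move=> s0; rewrite powR_gt0 // normr_gt0 gt_eqF. Qed.

Let powR_norm_le r s1 s2 : 0 <= r -> 0 <= s1 -> s1 <= s2 ->
  `|s1| `^ r <= `|s2| `^ r.
Proof.
move=> r0 s10 s12; apply: ge0_ler_powR; rewrite ?nnegrE ?normr_ge0 //.
by rewrite !ger0_norm // (le_trans s10).
Qed.

(** If [s > S], then [|s|^r >= |S|^r] and the flux inequality may be divided by [|s|^r]. If
    [s <= S], the bounds 0 <= u + H <= H suffice. Keeping the factor [u + H] in the conclusion
    allows it to vanish. *)
Lemma flux_le_neg r H S u s : 0 <= r -> 0 < S -> - H <= u -> u <= 0 ->
  (u + H) * (`|s| `^ r * s) <= H * (`|S| `^ r * S) -> (u + H) * s <= H * S.
Proof.
move=> r0 S0 uH u0 h; have [sS|Ss] := leP s S; first by nra.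
have s0 : 0 < s by lra.
have w0 := powR_norm_gt0 r _ s0.
have wS : `|S| `^ r <= `|s| `^ r by apply: powR_norm_le => //; apply: ltW.
rewrite -(ler_pM2l w0) mulrCA (le_trans h) //.
by rewrite mulrCA ler_wpM2r // mulr_ge0 ?(ltW S0) //; lra.
Qed.

(** A slope above [S] has the strictly larger power, and the weight [u + H >= H] preserves the
    strict excess. *)
Lemma flux_le_pos r H S u s : 0 <= r -> 0 < H -> 0 < S -> 0 <= u ->
  (u + H) * (`|s| `^ r * s) <= H * (`|S| `^ r * S) -> s <= S.
Proof.
move=> r0 H0 S0 u0 h; rewrite leNgt; apply/negP => Ss.
have s0 : 0 < s by lra.
have w0 := powR_norm_gt0 r _ s0.
have wS : `|S| `^ r <= `|s| `^ r by apply: powR_norm_le => //; apply: ltW.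
have h1 : `|S| `^ r * S < `|s| `^ r * s.
  by apply: (le_lt_trans (ler_wpM2r (ltW S0) wS)); rewrite ltr_pM2l.
have : H * (`|S| `^ r * S) < H * (`|s| `^ r * s) by rewrite ltr_pM2l.
have : 0 <= u * (`|s| `^ r * s) by rewrite !mulr_ge0 // ltW.
by move: h; rewrite mulrDl; lra.
Qed.

Lemma flux_ge_neg r H S u s : 0 <= r -> 0 < H -> 0 < S -> - H <= u -> u <= 0 ->
  H * (`|S| `^ r * S) <= (u + H) * (`|s| `^ r * s) -> S <= s.
Proof.
move=> r0 H0 S0 uH u0 h; rewrite leNgt; apply/negP => sS.
have pS : 0 < H * (`|S| `^ r * S) by rewrite !mulr_gt0 // powR_norm_gt0.
have [s0|s0] := leP s 0.
  have : (u + H) * (`|s| `^ r * s) <= 0.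
    by rewrite mulr_ge0_le0 // ?mulr_ge0_le0 //; lra.
  lra.
have wS : `|s| `^ r <= `|S| `^ r by apply: powR_norm_le => //; apply: ltW.
have w0 := powR_norm_gt0 r _ S0.
have h1 : `|s| `^ r * s < `|S| `^ r * S.
  by apply: (le_lt_trans (ler_wpM2r (ltW s0) wS)); rewrite ltr_pM2l.
have : H * (`|s| `^ r * s) < H * (`|S| `^ r * S) by rewrite ltr_pM2l.
have : u * (`|s| `^ r * s) <= 0 by rewrite mulr_le0_ge0 // mulr_ge0 // ltW.
by move: h; rewrite mulrDl; lra.
Qed.

(** Only 0 < s < S matters: a slope [s <= 0] contradicts the positive lower bound. Dividing by
    [|S|^r] gives H S <= (u + H) s, hence H (s - S) >= - u s >= - S u. *)
Lemma flux_ge_pos r H S u s : 0 <= r -> 0 < H -> 0 < S -> 0 <= u ->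
  H * (`|S| `^ r * S) <= (u + H) * (`|s| `^ r * s) -> - (S * u) <= H * (s - S).
Proof.
move=> r0 H0 S0 u0 h.
have [Ss|sS] := leP S s.
  have : 0 <= S * u by rewrite mulr_ge0 // ltW.
  have : 0 <= H * (s - S) by rewrite mulr_ge0 ?subr_ge0 // ltW.
  lra.
have pS : 0 < H * (`|S| `^ r * S) by rewrite !mulr_gt0 // powR_norm_gt0.
have [s0|s0] := leP s 0.
  have : (u + H) * (`|s| `^ r * s) <= 0.
    by rewrite mulr_ge0_le0 // ?mulr_ge0_le0 //; lra.
  lra.
have wS : `|s| `^ r <= `|S| `^ r by apply: powR_norm_le => //; apply: ltW.
have w0 := powR_norm_gt0 r _ s0.
have : H * S <= (u + H) * s.
  rewrite -(ler_pM2l w0) [leRHS]mulrCA; apply: le_trans h.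
  by rewrite mulrCA ler_wpM2l ?ler_wpM2r // ltW.
by nra.
Qed.

End FluxInequalities.

(** * Comparison of the solution with zero on either side of a point *)

Section Comparison.
Context {R : realType}.
Notation mu := (@lebesgue_measure R).
Implicit Types a b x : R.
Context (r H S k : R) (u du G : R -> R).
Context (r0 : 0 <= r) (H0 : 0 < H) (S0 : 0 < S) (k0 : 0 < k).
Context (intdu : mu.-integrable (@Omega R) (EFin \o du))
  (cu : {within `[-1, 1], continuous u})
  (uE : forall x, -1 <= x <= 1 -> u x = \int[mu]_(t in `]-1, x]) du t)
  (u1 : u 1 = 0) (uH : forall x, -1 <= x <= 1 -> - H <= u x).
Notation s := (fun x => du x * k + S).
Notation g0 := (H * (`|S| `^ r * S)).
Context (flux : {ae mu, forall x, -1 < x < 1 ->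
  (u x + H) * (`|s x| `^ r * s x) = G x}).

Let um1 : u (-1) = 0.
Proof.
rewrite uE; last by rewrite lexx /=; lra.
by rewrite set_itv_ge ?bnd_simp // Rintegral_set0.
Qed.

Let intdu_oo a b : -1 <= a -> b <= 1 -> mu.-integrable `]a, b[ (EFin \o du).
Proof.
move=> a1 b1; apply: integrableS intdu => //; first exact: measurable_Omega.
by apply: subset_itv; rewrite bnd_simp.
Qed.

Let intu_oo a b : -1 <= a -> b <= 1 -> mu.-integrable `]a, b[ (EFin \o u).
Proof.
move=> a1 b1.
have : mu.-integrable `[-1, 1] (EFin \o u).
  by apply: continuous_compact_integrable => //; exact: segment_compact.
by apply: integrableS => //; apply: subset_itv; rewrite bnd_simp.
Qed.

Let u_sub a b : -1 <= a -> a <= b -> b <= 1 ->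
  u b - u a = \int[mu]_(t in `]a, b]) du t.
Proof.
move=> a1 ab b1; rewrite !uE; [|by apply/andP; split; lra..].
rewrite (Rintegral_itvB (a := BRight (-1))) ?bnd_simp //.
have /integrable_itv_oo_cc := intdu_oo (-1) b (lexx _) b1.
by apply: integrableS => //; apply: subset_itv; rewrite bnd_simp.
Qed.

Let u_dist a b : -1 <= a -> b <= 1 ->
  forall x (e : R), a <= x <= b -> 0 < e ->
    exists2 d : R, 0 < d & forall y, a <= y <= b -> `|x - y| < d ->
      `|u x - u y| < e.
Proof.
move=> a1 b1 x e /andP[ax xb] e0.
have [|d d0 hd] := within_continuous_dist u (-1) 1 x e cu _ e0.
  by apply/andP; split; lra.
by exists d => // y /andP[ay yb]; apply: hd; apply/andP; split; lra.
Qed.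

Let u_within a b : -1 <= a -> b <= 1 -> {within `[a, b], continuous u}.
Proof.
move=> a1 b1; apply: continuous_subspaceW cu.
by apply: subset_itv; rewrite bnd_simp.
Qed.

Lemma flux_ge_zero_left x0 : -1 <= x0 <= 1 ->
  (forall x, -1 < x < x0 -> g0 <= G x) -> u x0 <= 0 ->
  (forall x, -1 <= x <= x0 -> u x = 0) /\
  {ae mu, forall x, -1 < x < x0 -> G x = g0}.
Proof.
move=> /andP[x01 x02] hG ux0.
(* For [S = sin varphi] and [k = cos varphi] this is tan(varphi) / H. *)
pose c := S / (H * k).
have c0 : 0 <= c by rewrite divr_ge0 ?mulr_ge0 // ltW.
have ae1 : {ae mu, forall x, -1 < x < x0 ->
    (u x <= 0 -> 0 <= du x) /\ (0 <= u x -> - c * u x <= du x)}.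
  apply: ae_imp flux => x fx /andP[x1 x2].
  have x12 : -1 < x < 1 by apply/andP; split; lra.
  have h : g0 <= (u x + H) * (`|s x| `^ r * s x).
    by rewrite fx // hG // x1.
  split=> ux.
    have uHx : - H <= u x by apply: uH; rewrite !ltW //; case/andP: x12.
    have := flux_ge_neg _ _ _ _ _ r0 H0 S0 uHx ux h.
    by rewrite lerDr pmulr_lge0.
  have := flux_ge_pos _ _ _ _ _ r0 H0 S0 ux h.
  rewrite addrK => h2; have Hk : 0 < H * k by rewrite mulr_gt0.
  rewrite -(ler_pM2r Hk) /c.
  have -> : - (S / (H * k)) * u x * (H * k) = - (S * u x).
    by field; rewrite !gt_eqF.
  by rewrite (le_trans h2) // mulrCA.
have upos x : -1 <= x <= x0 -> 0 <= u x.
  move=> /andP[x1 x2]; rewrite leNgt; apply/negP => ux.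
  have xle1 : x <= 1 by lra.
  (* After the last zero [y] before [x] the function is negative, so [du >= 0] there and [u] cannot
     have decreased from [u y = 0]. *)
  have [y [y1 y2 y3 y4]] :=
    last_zero u (-1) x (u_dist _ _ (lexx _) xle1) x1 um1 ux.
  have := u_sub _ _ y1 (ltW y2) xle1.
  have : 0 <= \int[mu]_(t in `]y, x]) du t.
    have <- : \int[mu]_(t in `]y, x]) (0 : R) = 0.
      by rewrite Rintegral_cst // mul0r.
    apply: le_ae_Rintegral_itv; [exact: integrable0 | exact: intdu_oo |].
    apply: ae_imp ae1 => t ht /andP[t1 t2].
    have tx0 : -1 < t < x0 by apply/andP; split; lra.
    by apply: (ht tx0).1; apply/ltW/y4; rewrite t1 ltW.
  by rewrite y3; lra.
have ux00 : u x0 = 0.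
  by apply/eqP; rewrite eq_le ux0 upos // x01 lexx.
have uz : forall x, -1 <= x <= x0 -> u x = 0.
  (* Since [u x0 = 0], the value [u x] is minus the integral of [du] over ]x, x0], hence at most [c]
     times that of [u]. *)
  apply: (gronwall_backward u c) => //; first exact: u_within.
  move=> x xx0; rewrite upos //=; move: xx0 => /andP[x1 x2].
  have intu := intu_oo x x0 x1 x02.
  have := u_sub _ _ x1 x2 x02; rewrite ux00 sub0r => /eqP.
  rewrite eqr_oppLR => /eqP ->.
  have : \int[mu]_(t in `]x, x0]) (- c * u t) <= \int[mu]_(t in `]x, x0]) du t.
    apply: le_ae_Rintegral_itv; [exact: integrable_scale | exact: intdu_oo |].
    apply: ae_imp ae1 => t ht /andP[t1 t2].
    have tx0 : -1 < t < x0 by apply/andP; split; lra.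
    by apply: (ht tx0).2; apply: upos; rewrite !ltW //; lra.
  rewrite RintegralZl //; first by rewrite mulNr lerNl.
  have /integrable_itv_oo_cc := intu.
  by apply: integrableS => //; apply: subset_itv; rewrite bnd_simp.
split => //.
(* With [u = 0] the derivative is nonnegative and has integral zero; substituting [u = du = 0] into
   the flux then yields [g0]. *)
have du0 : {ae mu, forall x, -1 < x < x0 -> du x = 0}.
  apply: ae_eq0_of_Rintegral_le0 => //; first exact: intdu_oo.
    apply: ae_imp ae1 => t ht tx0; apply: (ht tx0).1.
    by move: tx0 => /andP[t1 t2]; rewrite uz // !ltW.
  by rewrite -u_sub // um1 ux00 subrr.
apply: ae_imp2 du0 flux => x dux fx xx0; move: (xx0) => /andP[x1 x2].
rewrite -fx; last by rewrite x1 /=; lra.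
by rewrite dux // uz ?mul0r ?add0r // !ltW.
Qed.

Lemma flux_le_zero_right x0 : -1 <= x0 <= 1 ->
  (forall x, x0 < x < 1 -> G x <= g0) -> u x0 <= 0 ->
  (forall x, x0 <= x <= 1 -> u x = 0) /\
  {ae mu, forall x, x0 < x < 1 -> G x = g0}.
Proof.
move=> /andP[x01 x02] hG ux0.
(* The weight [u + H] may vanish where [u] is negative, so the differential inequality is used only
   where [u >= - H / 2]. There [u + H >= H / 2], whence the factor 2. *)
pose c := 2 * (S / (H * k)).
have c0 : 0 <= c by rewrite mulr_ge0 // divr_ge0 ?mulr_ge0 // ltW.
have ae1 : {ae mu, forall x, x0 < x < 1 ->
    (0 <= u x -> du x <= 0) /\
    (u x <= 0 -> - (H / 2) <= u x -> du x <= - c * u x)}.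
  apply: ae_imp flux => x fx /andP[x1 x2].
  have x12 : -1 < x < 1 by apply/andP; split; lra.
  have h : (u x + H) * (`|s x| `^ r * s x) <= g0.
    by rewrite fx // hG // x1.
  split=> [ux|ux uH2].
    have := flux_le_pos _ _ _ _ _ r0 H0 S0 ux h.
    by rewrite gerDr pmulr_lle0.
  have uHx : - H <= u x by apply: uH; rewrite !ltW //; case/andP: x12.
  have h2 := flux_le_neg _ _ _ _ _ r0 S0 uHx ux h.
  have [d0|d0] := leP (du x) 0.
    by apply: (le_trans d0); rewrite mulNr oppr_ge0 mulr_ge0_le0.
  have Hk : 0 < H * k by rewrite mulr_gt0.
  rewrite -(ler_pM2r Hk) /c.
  have -> : - (2 * (S / (H * k))) * u x * (H * k) = - (2 * (S * u x)).
    by field; rewrite !gt_eqF.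
  have dk : 0 < du x * k by rewrite mulr_gt0.
  have : H / 2 * (du x * k) <= (u x + H) * (du x * k).
    by rewrite ler_wpM2r ?(ltW dk) //; lra.
  by move: h2; rewrite mulrDr mulrDl; lra.
have upos x : x0 <= x <= 1 -> 0 <= u x.
  move=> /andP[x1 x2]; rewrite leNgt; apply/negP => ux.
  have xm1 : -1 <= x by lra.
  (* Near the first zero [y] after [x], continuity keeps [u] in [-H/2, 0] on some [z, y]. Gronwall
     applied to [- u] gives [u z = 0], although [u < 0] before [y]. *)
  have [y [y1 y2 y3 y4]] := first_zero u x 1 (u_dist _ _ xm1 (lexx _)) x2 ux u1.
  have y11 : -1 <= y <= 1 by apply/andP; split; lra.
  have [|d d0 hd] := u_dist _ _ (lexx _) (lexx _) y (H / 2) y11.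
    by rewrite divr_gt0.
  pose z := Num.max x (y - d / 2).
  have xz : x <= z by rewrite le_max lexx.
  have zy : z < y by rewrite gt_max y1 /=; lra.
  have dz : y - d / 2 <= z by rewrite le_max lexx orbT.
  have un t : z <= t <= y -> u t <= 0 /\ - (H / 2) <= u t.
    move=> /andP[zt ty]; split.
      have [ty'|yt] := ltP t y; first by apply/ltW/y4; apply/andP; split; lra.
      have -> : t = y by lra.
      by rewrite y3.
    have : `|u y - u t| < H / 2.
      apply: hd; first by apply/andP; split; lra.
      by rewrite ltr_norml; apply/andP; split; lra.
    by rewrite y3 ltr_norml => /andP[]; lra.
  have : - u z = 0.
    apply: (gronwall_backward (fun t => - u t) c z y) => //.
    - exact: ltW.
    - have cu' : {within `[z, y], continuous u} by apply: u_within; lra.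
      by move=> t; apply: cvgN; exact: cu'.
    - move=> t zty; have [ut1 ut2] := un t zty; rewrite oppr_ge0 ut1 /=.
      move: zty => /andP[zt ty].
      have t1 : -1 <= t by lra.
      have intu := intu_oo t y t1 y2.
      have -> : - u t = \int[mu]_(w in `]t, y]) du w.
        by rewrite -u_sub // y3 sub0r.
      have : \int[mu]_(w in `]t, y]) du w <=
          \int[mu]_(w in `]t, y]) (- c * u w).
        apply: le_ae_Rintegral_itv;
          [exact: intdu_oo | exact: integrable_scale |].
        apply: ae_imp ae1 => w hw /andP[w1 w2].
        have [uw1 uw2] : u w <= 0 /\ - (H / 2) <= u w.
          by apply: un; apply/andP; split; lra.
        by apply: (hw _).2 => //; apply/andP; split; lra.
      have intuc : mu.-integrable `]t, y] (EFin \o u).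
        have /integrable_itv_oo_cc := intu.
        by apply: integrableS => //; apply: subset_itv; rewrite bnd_simp.
      move=> /le_trans; apply.
      have -> : \int[mu]_(w in `]t, y]) - u w = - \int[mu]_(w in `]t, y]) u w.
        rewrite -mulN1r -RintegralZl //.
        by under eq_Rintegral do rewrite -mulN1r.
      by rewrite RintegralZl // mulNr mulrN.
    - by rewrite lexx ltW.
  have : u z < 0 by apply: y4; rewrite xz.
  lra.
(* Now [u >= 0] makes [du <= 0], so [u] cannot rise above [u x0 <= 0]. *)
have uz x : x0 <= x <= 1 -> u x = 0.
  move=> xx0; apply/eqP; rewrite eq_le upos // andbT; move: xx0 => /andP[x1 x2].
  have := u_sub _ _ x01 x1 x2.
  have : \int[mu]_(t in `]x0, x]) du t <= 0.
    have <- : \int[mu]_(t in `]x0, x]) (0 : R) = 0.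
      by rewrite Rintegral_cst // mul0r.
    apply: le_ae_Rintegral_itv; [exact: intdu_oo | exact: integrable0 |].
    apply: ae_imp ae1 => t ht /andP[t1 t2].
    by apply: (ht _).1; [|apply: upos]; apply/andP; split; lra.
  lra.
split => //.
have du0 : {ae mu, forall x, x0 < x < 1 -> - du x = 0}.
  apply: (ae_eq0_of_Rintegral_le0 (fun x => - du x)) => //.
  - rewrite (_ : (fun x => - du x) = (fun x => -1 * du x)).
      by apply: integrable_scale => //; exact: intdu_oo.
    by apply/funext => x; rewrite mulN1r.
  - apply: ae_imp ae1 => t ht tx0; rewrite oppr_ge0; apply: (ht tx0).1.
    by move: tx0 => /andP[t1 t2]; rewrite uz // !ltW.
  - have -> : \int[mu]_(w in `]x0, 1]) - du w = - \int[mu]_(w in `]x0, 1]) du w.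
      rewrite -mulN1r -RintegralZl //.
        by under eq_Rintegral do rewrite -mulN1r.
      have /integrable_itv_oo_cc := intdu_oo x0 1 x01 (lexx _).
      by apply: integrableS => //; apply: subset_itv; rewrite bnd_simp.
    by rewrite -u_sub // u1 uz ?lexx // subrr oppr0.
apply: ae_imp2 du0 flux => x dux fx xx0; move: (xx0) => /andP[x1 x2].
rewrite -fx; last by rewrite x2 andbT; lra.
have -> : du x = 0 by have := dux xx0; lra.
by rewrite uz ?mul0r ?add0r // !ltW.
Qed.

End Comparison.

(** * Integrability of the flux *)

Section FluxIntegrability.
Context {R : realType}.
Notation mu := (@lebesgue_measure R).
Implicit Types (u du : R -> R) (p : R).

(** With m = max(|d|, 1), |s| <= 2m and m^(p-1) <= m^p <= |d|^p + 1. The exponent is raised to [p]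
    because |u'|^p is known to be integrable. *)
Lemma flux_power_bound p (d s : R) : 2 < p -> `|s| <= `|d| + 1 ->
  `| `|s| `^ (p - 2) * s| <= 2 `^ (p - 2) * 2 * (`|d| `^ p + 1).
Proof.
move=> p2 sd; pose m := Num.max `|d| 1.
have m1 : 1 <= m by rewrite le_max lexx orbT.
have m0 : 0 <= m by lra.
have dm : `|d| <= m by rewrite le_max lexx.
have s2m : `|s| <= 2 * m by lra.
have p20 : 0 <= p - 2 by lra.
rewrite normrM (ger0_norm (powR_ge0 _ _)).
apply: (@le_trans _ _ ((2 * m) `^ (p - 2) * (2 * m))).
  apply: ler_pM => //.
  by apply: ge0_ler_powR => //; rewrite nnegrE ?mulr_ge0.
rewrite powRM // mulrACA ler_wpM2l ?mulr_ge0 ?powR_ge0 //.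
apply: (@le_trans _ _ (m `^ p)).
  rewrite -{2}(powRr1 m0) -powRD; last by apply/implyP => _; lra.
  by apply: ler_powR => //; lra.
have [d1|d1] := leP 1 `|d|.
  have -> : m = `|d| by rewrite /m maxEle; case: ifP => // h; lra.
  by rewrite lerDl.
have -> : m = 1 by rewrite /m maxEle ltW.
by rewrite powR1 lerDr powR_ge0.
Qed.

(** The weight [u + H] is bounded by continuity; the power of the slope is dominated through
    [flux_power_bound], as sine and cosine are at most 1 in absolute value. *)
Lemma flux_integrable p (H varphi : R) u du : 2 < p -> LpOmega p du ->
  {within `[-1, 1], continuous u} ->
  mu.-integrable Omega (EFin \o (fun x =>
    (u x + H) * (`|slope varphi du x| `^ (p - 2) * slope varphi du x))).
Proof.
move=> p2 Ldu cu.
have mdu := LpOmega_measurable _ _ Ldu.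
have ms : measurable_fun Omega (slope varphi du).
  apply: measurable_funD; last exact: measurable_cst.
  by apply: measurable_funM => //; exact: measurable_cst.
have mw : measurable_fun Omega
    (fun x => `|slope varphi du x| `^ (p - 2) * slope varphi du x).
  apply: measurable_funM => //.
  apply: (measurableT_comp (measurable_powR (p - 2))).
  exact: measurableT_comp.
have intw : mu.-integrable Omega (EFin \o
    (fun x => `|slope varphi du x| `^ (p - 2) * slope varphi du x)).
  have intb : mu.-integrable Omega (EFin \o
      (fun x => 2 `^ (p - 2) * 2 * (`|du x| `^ p + 1))).
    apply: integrable_scale; first exact: measurable_Omega.
    have intp : mu.-integrable Omega (EFin \o (fun x => `|du x| `^ p)).
      have p1 : 1 <= p by lra.
      have := @integrableS _ _ _ mu setT Omega _ measurableT measurable_Omega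
        (@subsetT _ _) (Lfun_integrable p1 Ldu).
      apply: eq_integrable; first exact: measurable_Omega.
      by move=> x xO; rewrite /= patchE xO.
    have int1 : mu.-integrable Omega (EFin \o (fun=> 1)).
      apply: (integrable_itv_bounded _ _ _ _ _ 1) => // x _.
      by rewrite normr1.
    have := @integrableD _ _ _ mu _ measurable_Omega _ _ intp int1.
    by apply: eq_integrable => //; exact: measurable_Omega.
  apply: le_integrable intb => //=.
  - exact: measurable_Omega.
  - exact/measurable_EFinP.
  - move=> x _; rewrite lee_fin [leRHS]ger0_norm; last first.
      by rewrite !mulr_ge0 ?addr_ge0 ?powR_ge0.
    apply: flux_power_bound => //; rewrite /slope.
    apply: (le_trans (ler_normD _ _)); apply: lerD; last first.
      by rewrite ler_norml sin_geN1 sin_le1.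
    rewrite normrM ler_piMr // ler_norml cos_geN1 cos_le1 //.
have [M hM] : exists M, forall x, Omega x -> `|u x + H| <= M.
  have cn : {within `[-1, 1], continuous (fun x => `|u x|)}.
    by move=> x; apply: cvg_norm; exact: cu.
  have [c _ hc] := @EVT_max R (fun x => `|u x|) (-1) 1 ltac:(lra) cn.
  exists (`|u c| + `|H|) => x Ox; apply: (le_trans (ler_normD _ _)).
  by rewrite lerD2r hc //; move: Ox; exact: subset_itv_oo_cc.
have mu' : measurable_fun Omega (fun x => u x + H).
  apply: measurable_funD; last exact: measurable_cst.
  have mcc := subspace_continuous_measurable_fun
    (measurable_itv `[(-1 : R), 1]) cu.
  by apply: measurable_funS mcc => //; exact: subset_itv_oo_cc.
have := integrable_mul_bounded _ _ _ M measurable_Omega intw mu' hM.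
by under eq_fun do rewrite mulrC.
Qed.

End FluxIntegrability.

(** * Strict positivity, by contradiction at a point where [u <= 0] *)

Theorem theorem3p24 (R : realType) (p H varphi : R) (f u : R -> R)
    (hp : 2 < p) (hH : 0 < H) (hvarphi : 0 < varphi < pi / 2)
    (hf : (@lebesgue_measure R).-integrable (@Omega R) (EFin \o f))
    (hu : weak_solution p H varphi f u)
    (f_ge0 : {ae (@lebesgue_measure R), forall x, Omega x -> 0 <= f x})
    (f_neq0 : ~ {ae (@lebesgue_measure R), forall x, Omega x -> f x = 0}) :
  forall x : R, -1 < x < 1 -> 0 < u x.
Proof.
move=> x0 /andP[x01 x02]; rewrite ltNge; apply/negP => ux0.
apply: f_neq0; set mu := @lebesgue_measure R in hf hu f_ge0 *.
have [du [Wu uH weak]] := hu.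
have p0 : 0 < p by lra.
have p1 : 1 < p by lra.
have [uE u1] := W01p_primitive _ _ _ p1 Wu.
have [[Lu Ldu _] acu _] := Wu.
have cu := abs_continuous_within _ _ _ acu.
have intdu := LpOmega_integrable _ _ p1 Ldu.
have intF := flux_integrable p H varphi u du hp Ldu cu.
have [c aeF] := weak_primitive_ae _ f intF hf
  (fun v tv => weak v _ (test_W01p p v p0 tv)).
pose P x := \int[mu]_(t in `]-1, x]) f t.
have aeOmega (Q : R -> Prop) : {ae mu, forall x, Omega x -> Q x} ->
    {ae mu, forall x, -1 < x < 1 -> Q x}.
  by apply: ae_imp => x h x1; apply: h; rewrite /Omega /= in_itv.
have flux := aeOmega _ aeF.
have intf_oo a b : -1 <= a -> b <= 1 -> mu.-integrable `]a, b[ (EFin \o f).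
  move=> a1 b1; apply: integrableS hf => //; first exact: measurable_Omega.
  by apply: subset_itv; rewrite bnd_simp.
have P_sub a b : -1 <= a -> a <= b -> b <= 1 ->
    P b - P a = \int[mu]_(t in `]a, b]) f t.
  move=> a1 ab b1; rewrite /P (Rintegral_itvB (a := BRight (-1))) ?bnd_simp //.
  have /integrable_itv_oo_cc := intf_oo (-1) b (lexx _) b1.
  by apply: integrableS => //; apply: subset_itv; rewrite bnd_simp.
have P_mono a b : -1 <= a -> a <= b -> b <= 1 -> P a <= P b.
  move=> a1 ab b1; rewrite -subr_ge0 P_sub //.
  have <- : \int[mu]_(t in `]a, b]) (0 : R) = 0.
    by rewrite Rintegral_cst // mul0r.
  apply: le_ae_Rintegral_itv; [exact: integrable0 | exact: intf_oo |].
  apply: ae_imp f_ge0 => t ft /andP[t1 t2]; apply: ft.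
  by rewrite /Omega /= in_itv /=; apply/andP; split; lra.
have S0 : 0 < sin varphi.
  apply: sin_gt0_pi; have := pi_gt0 R; move: hvarphi => /andP[h1 h2].
  by move=> ?; apply/andP; split; lra.
have k0 : 0 < cos varphi.
  apply: cos_gt0_pihalf; have := pi_gt0 R; move: hvarphi => /andP[h1 h2].
  by move=> ?; apply/andP; split; lra.
set S := sin varphi in S0; set k := cos varphi in k0.
have r0 : 0 <= p - 2 by lra.
pose g0 := H * (`|S| `^ (p - 2) * S).
have Lf := flux_ge_zero_left (p - 2) H S k u du (fun x => c - P x)
  r0 hH S0 k0 intdu cu uE uH flux.
have Rt := flux_le_zero_right (p - 2) H S k u du (fun x => c - P x)
  r0 hH S0 k0 intdu cu uE u1 uH flux.
have x011 : -1 <= x0 <= 1 by rewrite !ltW.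
(* In either case the flux equals [g0] almost everywhere on one side of [x0]. Comparing [x0] with
   one such point, monotonicity of [P] supplies the missing inequality. *)
have Gx0 : c - P x0 = g0.
  have [le|/ltW ge] := leP g0 (c - P x0).
    have [|_ aeG] := Lf x0 x011 _ ux0.
      move=> x /andP[x1 x2]; apply: (le_trans le).
      by rewrite lerD2l lerN2 P_mono // !ltW.
    have [x /andP[x1 x2] /(_ (introT andP (conj x1 x2))) Gx] :=
      ae_exists_itv _ _ _ x01 aeG.
    apply/eqP; rewrite eq_le le andbT /g0 -Gx.
    by rewrite lerD2l lerN2 P_mono // !ltW.
  have [|_ aeG] := Rt x0 x011 _ ux0.
    move=> x /andP[x1 x2]; apply: (le_trans _ ge).
    by rewrite lerD2l lerN2 P_mono // !ltW.
  have [x /andP[x1 x2] /(_ (introT andP (conj x1 x2))) Gx] :=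
    ae_exists_itv _ _ _ x02 aeG.
  apply/eqP; rewrite eq_le ge /g0 -Gx.
  by rewrite lerD2l lerN2 P_mono // !ltW.
have [|_ aeL] := Lf x0 x011 _ ux0.
  by move=> x /andP[x1 x2]; rewrite -/g0 -Gx0 lerD2l lerN2 P_mono // !ltW.
have [|_ aeR] := Rt x0 x011 _ ux0.
  by move=> x /andP[x1 x2]; rewrite -/g0 -Gx0 lerD2l lerN2 P_mono // !ltW.
(* The two sides together give the equality almost everywhere, and continuity of [P] extends it to
   the closed interval. *)
have Pin x : -1 <= x <= 1 -> P x = c - g0.
  apply: (eq_continuous_ae _ (fun=> c - g0) (-1) 1); first lra.
  - apply: integral_continuous; first lra.
    exact: intf_oo.
  - by apply: continuous_subspaceT => y; exact: cvg_cst.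
  - apply: (ae_imp2 _ _ _ _ aeL aeR) => z hl hr /andP[x1 x2].
    have [xx0|xx0|->] := ltgtP z x0; last by lra.
      by have := hl (introT andP (conj x1 xx0)); rewrite -/g0; lra.
    by have := hr (introT andP (conj xx0 x2)); rewrite -/g0; lra.
(* The integral of [f >= 0] is [P 1 - P (-1) = 0], so [f] vanishes almost everywhere. *)
have fz := ae_eq0_of_Rintegral_le0 f (-1) 1 _ (intf_oo _ _ (lexx _) (lexx _))
  (aeOmega _ f_ge0).
apply: (ae_imp _ _ _ (fz _ _)).
- by move=> x h; rewrite /Omega /= in_itv.
- lra.
- rewrite -P_sub //; try lra.
  by rewrite !Pin ?subrr // lexx //=; lra.
Qed.
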